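(* Let $R$ be a field of characteristic $0$, $r\ge2$, $n\ge3$, and let $\Lambda=\Lambda_{j_1}+\Lambda_{j_2}+\dots+\Lambda_{j_r}$ be a dominant weight with $|j_a-j_b|>2$ for all $a\neq b$. Let $TL_{r,1,n}^{\Lambda}$ be the corresponding generalised Temperley-Lieb algebra over $R$. Then $TL_{r,1,n}^{\Lambda}$ is semisimple if and only if $|j_k-j_l|\geq n$ for all $1\leq k<l \leq r$.
   Context: Weights. $q\in R^*$, $q\neq1$; $e$ is the smallest positive integer with $1+q+\dots+q^{e-1}=0$, and $e=0$ if none exists; $I=\mathbb{Z}/e\mathbb{Z}$. For $a,b\in I$, $|a-b|:=\min\{|c-d| : c,d\in\mathbb{Z},\ c\equiv a,\ d\equiv b \bmod e\}$. The $\Lambda_i$ are fundamental weights and $\alpha_i$ simple roots ($i\in I$), with $(\Lambda_i,\alpha_j)=\delta_{ij}$. The hypotheses on $\Lambda$ force $e=0$ or $e\ge 6$. Write $i\to j$ (also $j\leftarrow i$) if $j=i+1$. KLR algebra. $\mathfrak S_n$ acts on $I^n$ by place permutation, $s_k$ swapping entries $k,k+1$. For each $\mathfrak S_n$-orbit $O\subseteq I^n$ let $\mathcal R_O^\Lambda$ be the unital associative $R$-algebra with generators $\psi_1,\dots,\psi_{n-1},y_1,\dots,y_n,e(\mathbf i)$ ($\mathbf i=(i_1,\dots,i_n)\in O$) and relations: $y_1^{(\Lambda,\alpha_{i_1})}e(\mathbf i)=0$; $e(\mathbf i)e(\mathbf j)=\delta_{\mathbf i\mathbf j}e(\mathbf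 i)$; $\sum_{\mathbf i\in O} e(\mathbf i)=1$; $e(\mathbf i)y_k=y_ke(\mathbf i)$; $\psi_ke(\mathbf i)=e(s_k\mathbf i)\psi_k$; $y_ky_l=y_ly_k$; $\psi_ky_l=y_l\psi_k$ if $l\ne k,k+1$; $\psi_k\psi_l=\psi_l\psi_k$ if $|k-l|\ne1$; $\psi_ky_{k+1}e(\mathbf i)=(y_k\psi_k+\delta_{i_k,i_{k+1}})e(\mathbf i)$; $y_{k+1}\psi_ke(\mathbf i)=(\psi_ky_k+\delta_{i_k,i_{k+1}})e(\mathbf i)$; $\psi_k^2e(\mathbf i)$ equals $0$ if $i_k=i_{k+1}$, $(y_{k+1}-y_k)e(\mathbf i)$ if $i_k\to i_{k+1}$, $(y_k-y_{k+1})e(\mathbf i)$ if $i_k\leftarrow i_{k+1}$, and $e(\mathbf i)$ otherwise; $(\psi_k\psi_{k+1}\psi_k-\psi_{k+1}\psi_k\psi_{k+1})e(\mathbf i)$ equals $e(\mathbf i)$ if $i_{k+2}=i_k\to i_{k+1}$, $-e(\mathbf i)$ if $i_{k+2}=i_k\leftarrow i_{k+1}$, and $0$ otherwise. Put $\mathcal R_n^\Lambda=\bigoplus_O\mathcal R_O^\Lambda$ (only finitely many summands are nonzero). Temperley-Lieb quotient. $\mathcal J_n$ is the two-sided ideal of $\mathcal R_n^\Lambda$ generated by all $e(\mathbf i)$ with $(\alpha_{i_1},\Lambda)>0$ and $i_2=i_1+1$, and all $e(\mathbf i)$ with $i_1,i_2,i_3$ pairwise distinct and $(\alpha_{i_a},\Lambda)>0$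 for $a=1,2,3$. $TL_{r,1,n}^\Lambda=\mathcal R_n^\Lambda/\mathcal J_n$. *)

(* Defs.v *)
From HB Require Import structures.
From mathcomp Require Import all_boot all_order all_algebra perm.
From mathcomp Require Import finmap boolp.
From mathcomp Require Import monalg.

Set Implicit Arguments.
Unset Strict Implicit.
Unset Printing Implicit Defensive.

Import Order.TTheory GRing.Theory Num.Theory.
Local Open Scope ring_scope.
Local Open Scope quotient_scope.

(* The algebras below are quotients of free R-algebras and products of such
   quotients. Only their underlying rings are recorded: every one-sided or
   two-sided ideal of a unital R-algebra is an R-submodule, so generating ideals
   and semisimplicity do not see the scalars. The rings are [pzRingType] (1 = 0
   allowed) because most of the algebras [KLR_orbit] are zero. *)

Section TwoSidedQuotient.
Variable A : pzRingType.

Record two_sided_ideal (J : A -> Prop) : Prop := TwoSidedIdeal {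
  ideal_0 : J 0;
  ideal_D : forall x y, J x -> J y -> J (x + y);
  ideal_Ml : forall a x, J x -> J (a * x);
  ideal_Mr : forall a x, J x -> J (x * a)
}.

Definition generated_ideal (S : A -> Prop) (x : A) : Prop :=
  forall J, two_sided_ideal J -> (forall s, S s -> J s) -> J x.

Lemma generated_ideal_ideal S : two_sided_ideal (generated_ideal S).
Proof.
split=> [J iJ _|x y Ix Iy J iJ SJ|a x Ix J iJ SJ|a x Ix J iJ SJ].
- exact: ideal_0.
- by apply: ideal_D => //; [apply: Ix | apply: Iy].
- by apply: ideal_Ml => //; apply: Ix.
- by apply: ideal_Mr => //; apply: Ix.
Qed.

Lemma generated_ideal_gen (S : A -> Prop) s : S s -> generated_ideal S s.
Proof. by move=> Ss J _; apply. Qed.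

Definition ideal_pred (S : A -> Prop) : A -> bool :=
  fun x => `[< generated_ideal S x >].

Lemma ideal_predP S x : reflect (generated_ideal S x) (x \in ideal_pred S).
Proof. exact: asboolP. Qed.

Lemma ideal_pred_zmod_closed S : zmod_closed (ideal_pred S).
Proof.
have iS := generated_ideal_ideal S.
split; first by apply/ideal_predP; apply: (ideal_0 iS).
move=> x y /ideal_predP Ix /ideal_predP Iy; apply/ideal_predP.
by rewrite -mulN1r; apply: (ideal_D iS) => //; apply: (ideal_Ml iS).
Qed.

HB.instance Definition _ S :=
  GRing.isZmodClosed.Build A (ideal_pred S) (ideal_pred_zmod_closed S).

(* The library makes [{ideal_quot I}] a ring only for commutative rings. *)
Definition ideal_closed (S : A -> Prop) : zmodClosed A :=
  GRing.ZmodClosed.clone A (ideal_pred S) _.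
Definition quot_ring (S : A -> Prop) := {ideal_quot (ideal_closed S)}.

Section Operations.
Variable S : A -> Prop.
Local Notation Q := (quot_ring S).

HB.instance Definition _ := GRing.Zmodule.on Q.
HB.instance Definition _ := ZmodQuotient.on Q.

Definition quot_one : Q := \pi_Q 1.
Definition quot_mul : Q -> Q -> Q := lift_op2 Q *%R.

Lemma quot_eqP (x y : A) :
  reflect (generated_ideal S (x - y)) (\pi_Q x == \pi_Q y).
Proof. by rewrite -Quotient.idealrBE; apply: ideal_predP. Qed.

Lemma quot_mulE (x y : A) : quot_mul (\pi_Q x) (\pi_Q y) = \pi_Q (x * y).
Proof.
have iS := generated_ideal_ideal S.
have piB z : generated_ideal S (repr (\pi_Q z) - z).
  by apply/quot_eqP; rewrite reprK.
unlock quot_mul; apply/eqP/quot_eqP; set x' := repr _; set y' := repr _.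
have -> : x' * y' - x * y = (x' - x) * y' + x * (y' - y).
  by rewrite mulrBl mulrBr addrA subrK.
apply: (ideal_D iS); [apply: (ideal_Mr iS) | apply: (ideal_Ml iS)]; exact: piB.
Qed.

Lemma quot_mulA : associative quot_mul.
Proof.
by move=> x y z; rewrite -[x]reprK -[y]reprK -[z]reprK !quot_mulE mulrA.
Qed.

Lemma quot_mul1r : left_id quot_one quot_mul.
Proof. by move=> x; rewrite -[x]reprK quot_mulE mul1r. Qed.

Lemma quot_mulr1 : right_id quot_one quot_mul.
Proof. by move=> x; rewrite -[x]reprK quot_mulE mulr1. Qed.

Lemma quot_mulrDl : left_distributive quot_mul +%R.
Proof.
move=> x y z; rewrite -[x]reprK -[y]reprK -[z]reprK !quot_mulE.
by rewrite -!pi_addr quot_mulE mulrDl.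
Qed.

Lemma quot_mulrDr : right_distributive quot_mul +%R.
Proof.
move=> x y z; rewrite -[x]reprK -[y]reprK -[z]reprK !quot_mulE.
by rewrite -!pi_addr quot_mulE mulrDr.
Qed.

HB.instance Definition _ := GRing.Zmodule_isPzRing.Build Q
  quot_mulA quot_mul1r quot_mulr1 quot_mulrDl quot_mulrDr.

Definition quot_proj (x : A) : Q := \pi_Q x.

Lemma quot_proj_zmod_morphism : zmod_morphism quot_proj.
Proof. by move=> x y; rewrite /quot_proj pi_addr pi_oppr. Qed.
Lemma quot_proj_monoid_morphism : monoid_morphism quot_proj.
Proof. by split=> // x y; rewrite /quot_proj -quot_mulE. Qed.
HB.instance Definition _ :=
  GRing.isZmodMorphism.Build A Q quot_proj quot_proj_zmod_morphism.
HB.instance Definition _ :=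
  GRing.isMonoidMorphism.Build A Q quot_proj quot_proj_monoid_morphism.
End Operations.
End TwoSidedQuotient.

Section ProductRing.
Variables (T : Type) (A : T -> pzRingType).

Definition prod_ring : Type := forall t, A t.
HB.instance Definition _ := Choice.on prod_ring.

Implicit Types x y z : prod_ring.

Lemma prod_ringP x y : (forall t, x t = y t) -> x = y.
Proof. exact: functional_extensionality_dep. Qed.

Definition prod_zero : prod_ring := fun t => 0.
Definition prod_opp x : prod_ring := fun t => - x t.
Definition prod_add x y : prod_ring := fun t => x t + y t.
Definition prod_one : prod_ring := fun t => 1.
Definition prod_mul x y : prod_ring := fun t => x t * y t.

Lemma prod_addA : associative prod_add.
Proof. by move=> x y z; apply: prod_ringP => t; apply: addrA. Qed.
Lemma prod_addC : commutative prod_add.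
Proof. by move=> x y; apply: prod_ringP => t; apply: addrC. Qed.
Lemma prod_add0 : left_id prod_zero prod_add.
Proof. by move=> x; apply: prod_ringP => t; apply: add0r. Qed.
Lemma prod_addN : left_inverse prod_zero prod_opp prod_add.
Proof. by move=> x; apply: prod_ringP => t; apply: addNr. Qed.
HB.instance Definition _ := GRing.isZmodule.Build prod_ring
  prod_addA prod_addC prod_add0 prod_addN.

Lemma prod_mulA : associative prod_mul.
Proof. by move=> x y z; apply: prod_ringP => t; apply: mulrA. Qed.
Lemma prod_mul1r : left_id prod_one prod_mul.
Proof. by move=> x; apply: prod_ringP => t; apply: mul1r. Qed.
Lemma prod_mulr1 : right_id prod_one prod_mul.
Proof. by move=> x; apply: prod_ringP => t; apply: mulr1. Qed.
Lemma prod_mulrDl : left_distributive prod_mul +%R.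
Proof. by move=> x y z; apply: prod_ringP => t; apply: mulrDl. Qed.
Lemma prod_mulrDr : right_distributive prod_mul +%R.
Proof. by move=> x y z; apply: prod_ringP => t; apply: mulrDr. Qed.
HB.instance Definition _ := GRing.Zmodule_isPzRing.Build prod_ring
  prod_mulA prod_mul1r prod_mulr1 prod_mulrDl prod_mulrDr.
End ProductRing.

(* A ring is semisimple if its left regular module is a direct sum of simple
   submodules; finitely many summands are enough, as 1 lies in a finite partial
   sum. The zero ring is semisimple (the empty sum). *)
Section Semisimple.
Variable A : pzRingType.

Record left_ideal (L : A -> Prop) : Prop := LeftIdeal {
  left_ideal_0 : L 0;
  left_ideal_D : forall x y, L x -> L y -> L (x + y);
  left_ideal_M : forall a x, L x -> L (a * x)
}.

Definition simple_left_ideal (L : A -> Prop) : Prop :=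
  [/\ left_ideal L,
      exists2 x, L x & x != 0 &
      forall M, left_ideal M -> (forall x, M x -> L x) ->
        (forall x, M x -> x = 0) \/ (forall x, L x -> M x)].

Definition semisimple : Prop :=
  exists m (L : 'I_m -> A -> Prop),
    (forall k, simple_left_ideal (L k)) /\
    (forall a, exists! x : {ffun 'I_m -> A},
       (forall k, L k (x k)) /\ a = \sum_k x k).
End Semisimple.

(* The smallest k > 0 with 1 + q + ... + q^(k-1) = 0, or 0 if there is none. *)
Definition quantum_char (F : fieldType) (q : F) : nat :=
  if pselect (exists k, (0 < k)%N && (\sum_(i < k) q ^+ i == 0)) is left ex
  then ex_minn ex else 0%N.

(* Z/eZ; this is Z for e = 0. *)
Definition residue (e : nat) :=
  {ideal_quot (GRing.ZmodClosed.clone int (dvdz e%:Z) _)}.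
HB.instance Definition _ e := GRing.Zmodule.on (residue e).

Definition res (e : nat) (c : int) : residue e := \pi_(residue e) c.

Definition arrow (e : nat) (i j : residue e) : bool := j == i + res e 1.

Section ResidueDistance.
Variables (e : nat) (a b : residue e).

Definition is_distance (m : nat) : bool :=
  `[< exists c d : int, [/\ res e c = a, res e d = b & m = `|c - d|%N] >].

Lemma ex_distance : exists m, is_distance m.
Proof.
exists `|repr a - repr b|%N; apply/asboolP; exists (repr a), (repr b).
by rewrite /res !reprK.
Qed.

Definition residue_dist : nat := ex_minn ex_distance.
End ResidueDistance.

(* A dominant weight is a sum of fundamental weights; it is represented by its
   coordinates L i = (L, alpha_i). *)
Definition weight (e : nat) := residue e -> nat.

Definition fundamental (e : nat) (i : residue e) : weight e :=
  fun k => (i == k) : nat.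

Definition weight_sum (e r : nat) (j : 'I_r -> residue e) : weight e :=
  fun k => (\sum_(a < r) fundamental (j a) k)%N.

Section Place.
Variable n : nat.

(* For k : 'I_n.-1, the positions k and k + 1. *)
Definition pos (k : 'I_n.-1) : 'I_n := widen_ord (leq_pred n) k.

Lemma pos_next_subproof (k : 'I_n.-1) : (k.+1 < n)%N.
Proof. by move: k; case: n => [|n'] []. Qed.
Definition pos_next (k : 'I_n.-1) : 'I_n := Ordinal (pos_next_subproof k).

Variable I : choiceType.

Definition place_perm (s : 'S_n) (i : I ^ n) : I ^ n :=
  [ffun k => i (s^-1%g k)].

Definition place_swap (k : 'I_n.-1) (i : I ^ n) : I ^ n :=
  place_perm (tperm (pos k) (pos_next k)) i.

Definition place_orbit (i : I ^ n) : {fset (I ^ n)} :=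
  [fset place_perm s i | s in {: 'S_n}]%fset.

Record perm_orbit := PermOrbit {
  orbit_set :> {fset (I ^ n)};
  orbitP : exists i, orbit_set = place_orbit i
}.
End Place.

Section Presentation.
Variables (R : comNzRingType) (e n : nat) (L : weight e).
Local Notation I := (residue e).
Variable O : perm_orbit n I.

Inductive generator : Type :=
  | Psi of 'I_n.-1
  | Y of 'I_n
  | E of orbit_set O.
HB.instance Definition _ := gen_eqMixin generator.
HB.instance Definition _ := gen_choiceMixin generator.

(* The free associative unital R-algebra on the generators. *)
Definition free_alg := {malg R[{fmonom generator}]}.
HB.instance Definition _ := GRing.NzRing.on free_alg.

Definition gen (g : generator) : free_alg := << fmu g >>.
Local Notation psi k := (gen (Psi k)).
Local Notation y k := (gen (Y k)).

(* The generator e(i) for i in O, and 0 for i outside O. *)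
Definition gen_e (i : I ^ n) : free_alg :=
  if insub i is Some u then gen (E u) else 0.

(* For e = 2 both arrows hold at once and the first one is used; the weights of
   interest force e = 0 or e >= 6. *)
Definition psi_square (k : 'I_n.-1) (i : I ^ n) : free_alg :=
  let a := i (pos k) in let b := i (pos_next k) in
  if a == b then 0
  else if arrow a b then (y (pos_next k) - y (pos k)) * gen_e i
  else if arrow b a then (y (pos k) - y (pos_next k)) * gen_e i
  else gen_e i.

Definition psi_braid (k l : 'I_n.-1) (i : I ^ n) : free_alg :=
  let a := i (pos k) in let b := i (pos l) in let c := i (pos_next l) in
  if (c == a) && arrow a b then gen_e i
  else if (c == a) && arrow b a then - gen_e i
  else 0.

Inductive KLR_rel : free_alg -> free_alg -> Prop :=
  | rel_cyclotomic (i : I ^ n) (k : 'I_n)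
        of i \in orbit_set O & k = 0%N :> nat :
      KLR_rel (y k ^+ L (i k) * gen_e i) 0
  | rel_ee (i j : I ^ n) of i \in orbit_set O & j \in orbit_set O :
      KLR_rel (gen_e i * gen_e j) (if i == j then gen_e i else 0)
  | rel_sum : KLR_rel (\sum_(i <- orbit_set O) gen_e i) 1
  | rel_ey (i : I ^ n) (k : 'I_n) of i \in orbit_set O :
      KLR_rel (gen_e i * y k) (y k * gen_e i)
  | rel_psie (i : I ^ n) (k : 'I_n.-1) of i \in orbit_set O :
      KLR_rel (psi k * gen_e i) (gen_e (place_swap k i) * psi k)
  | rel_yy (k l : 'I_n) :
      KLR_rel (y k * y l) (y l * y k)
  | rel_psiy (k : 'I_n.-1) (l : 'I_n) of l != pos k & l != pos_next k :
      KLR_rel (psi k * y l) (y l * psi k)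
  | rel_psipsi (k l : 'I_n.-1) of k.+1 != l & l.+1 != k :
      KLR_rel (psi k * psi l) (psi l * psi k)
  | rel_psiy_next (i : I ^ n) (k : 'I_n.-1) of i \in orbit_set O :
      KLR_rel (psi k * y (pos_next k) * gen_e i)
        ((y (pos k) * psi k + (i (pos k) == i (pos_next k))%:R) * gen_e i)
  | rel_ypsi_next (i : I ^ n) (k : 'I_n.-1) of i \in orbit_set O :
      KLR_rel (y (pos_next k) * psi k * gen_e i)
        ((psi k * y (pos k) + (i (pos k) == i (pos_next k))%:R) * gen_e i)
  | rel_square (i : I ^ n) (k : 'I_n.-1) of i \in orbit_set O :
      KLR_rel (psi k ^+ 2 * gen_e i) (psi_square k i)
  | rel_braid (i : I ^ n) (k l : 'I_n.-1)
        of i \in orbit_set O & l = k.+1 :> nat :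
      KLR_rel ((psi k * psi l * psi k - psi l * psi k * psi l) * gen_e i)
        (psi_braid k l i).

Definition relator (x : free_alg) : Prop :=
  exists lhs rhs, KLR_rel lhs rhs /\ x = lhs - rhs.

Definition KLR_orbit := quot_ring relator.
HB.instance Definition _ := GRing.PzRing.on KLR_orbit.

Definition orbit_e (i : I ^ n) : KLR_orbit := quot_proj relator (gen_e i).
End Presentation.

Section KLR.
Variables (R : comNzRingType) (e n : nat) (L : weight e).
Local Notation I := (residue e).

(* The direct sum of the algebras [KLR_orbit R L O]. It is the product, because
   almost all of these algebras are zero, see [KLR_finite_support]. *)
Definition KLR :=
  prod_ring (fun O : perm_orbit n I => KLR_orbit R L O : pzRingType).
HB.instance Definition _ := GRing.PzRing.on KLR.

Definition KLR_e (i : I ^ n) : KLR := fun O => orbit_e R L O i.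

Inductive TL_generator : KLR -> Prop :=
  | TL_two (i : I ^ n) (k1 k2 : 'I_n)
        of k1 = 0%N :> nat & k2 = 1%N :> nat
        & (0 < L (i k1))%N & i k2 = i k1 + res e 1 :
      TL_generator (KLR_e i)
  | TL_three (i : I ^ n) (k1 k2 k3 : 'I_n)
        of k1 = 0%N :> nat & k2 = 1%N :> nat & k3 = 2%N :> nat
        & uniq [:: i k1; i k2; i k3]
        & [/\ (0 < L (i k1))%N, (0 < L (i k2))%N & (0 < L (i k3))%N] :
      TL_generator (KLR_e i).

Definition TL := quot_ring TL_generator.
HB.instance Definition _ := GRing.PzRing.on TL.
End KLR.

Section FiniteSupport.
Variables (R : comNzRingType) (e n : nat).
Local Notation I := (residue e).

Lemma place_permM (s t : 'S_n) (i : I ^ n) :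
  place_perm s (place_perm t i) = place_perm (t * s)%g i.
Proof. by apply/ffunP => k; rewrite !ffunE fingroup.invMg permM. Qed.

Lemma place_orbitP (i j : I ^ n) :
  reflect (exists s, j = place_perm s i) (j \in place_orbit i).
Proof.
by apply: (iffP (imfsetP _ _ _ _)) => [[s _ ->]|[s ->]]; exists s.
Qed.

Lemma place_orbit_perm (s : 'S_n) (i : I ^ n) :
  place_orbit (place_perm s i) = place_orbit i.
Proof.
apply/fsetP => j; apply/place_orbitP/place_orbitP => -[t ->].
  by exists (s * t)%g; rewrite place_permM.
by exists (s^-1 * t)%g; rewrite place_permM fingroup.mulKVg.
Qed.

Lemma mem_orbit (O : perm_orbit n I) i :
  i \in orbit_set O -> orbit_set O = place_orbit i.
Proof.
have [j ->] := orbitP O; move=> /place_orbitP[s ->].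
by rewrite place_orbit_perm.
Qed.

Lemma mem_place_swap (O : perm_orbit n I) i k :
  i \in orbit_set O -> place_swap k i \in orbit_set O.
Proof.
by move=> /mem_orbit->; apply/place_orbitP; exists (tperm (pos k) (pos_next k)).
Qed.

Variable L : weight e.

Lemma KLR_relP (O : perm_orbit n I) (lhs rhs : free_alg R O) :
  KLR_rel L lhs rhs ->
  quot_proj (relator L (O := O)) lhs = quot_proj (relator L (O := O)) rhs.
Proof.
move=> rel; apply/eqP/quot_eqP.
by apply: (@generated_ideal_gen _ (relator L (O := O))); exists lhs, rhs.
Qed.

(* e(i) = 0 if some entry of i is not a summand of the weight and is neither
   equal nor adjacent to an earlier entry: it can be moved to the front. *)
Lemma orbit_e_eq0 (O : perm_orbit n I) (i : I ^ n) (k : 'I_n) :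
  i \in orbit_set O -> L (i k) = 0%N ->
  (forall l : 'I_n, (l < k)%N ->
     [/\ i l != i k, ~~ arrow (i l) (i k) & ~~ arrow (i k) (i l)]) ->
  orbit_e R L O i = 0.
Proof.
case: k => m; elim: m i => [|m IHm] i lt_n Oi Li0 far.
  have := KLR_relP (rel_cyclotomic R L (k := Ordinal lt_n) Oi erefl).
  by rewrite Li0 expr0 mul1r rmorph0.
have lt_n1 : (m < n.-1)%N by rewrite ltn_predRL.
pose k := Ordinal lt_n1.
have ek : pos_next k = Ordinal lt_n by apply: val_inj.
have nk : (pos k == pos_next k) = false by rewrite -val_eqE /= ltn_eqF.
have swapk : place_swap k i (pos k) = i (Ordinal lt_n).
  by rewrite ffunE tpermV tpermL ek.
have ok : Ordinal (ltnW lt_n) = pos k by apply: val_inj.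
have e_swap : orbit_e R L O (place_swap k i) = 0.
  apply: (IHm _ (ltnW lt_n)); first exact: mem_place_swap.
    by rewrite ok swapk.
  move=> l /= ltlm; rewrite ok swapk ffunE tpermV tpermD.
  - by apply: far; apply: ltnW.
  - by rewrite -val_eqE /= gtn_eqF.
  - by rewrite -val_eqE /= gtn_eqF // ltnW.
have [] := far (pos k) (ltnSn m); rewrite -ek => ne1 ne2 ne3.
have := KLR_relP (@rel_square R _ _ L _ i k Oi).
rewrite /psi_square (negPf ne1) (negPf ne2) (negPf ne3) /orbit_e => <-.
rewrite expr2 -mulrA rmorphM /=.
rewrite (KLR_relP (@rel_psie R _ _ L _ i k Oi)) rmorphM /=.
have -> : quot_proj (relator L (O := O)) (gen_e R O (place_swap k i)) = 0 by [].
by rewrite mul0r mulr0.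
Qed.

Definition widen_residues (s : seq I) : seq I :=
  s ++ [seq a + res e 1 | a <- s] ++ [seq a - res e 1 | a <- s].

Lemma widen_residues_sub (s : seq I) a b : (a <= b)%N ->
  {subset iter a widen_residues s <= iter b widen_residues s}.
Proof.
move=> /subnKC <-; elim: (b - a)%N => [|d IHd] x; first by rewrite addn0.
by move=> /IHd xs; rewrite addnS iterS mem_cat xs.
Qed.

Lemma orbit_e_neq0 (s : seq I) (O : perm_orbit n I) (i : I ^ n) :
  (forall a, a \notin s -> L a = 0%N) -> i \in orbit_set O ->
  orbit_e R L O i != 0 -> forall k, i k \in iter n widen_residues s.
Proof.
move=> sL Oi nz k.
suff: i k \in iter k.+1 widen_residues s by apply: widen_residues_sub.
case: k => m; elim/ltn_ind: m => m IHm lt_n; set k := Ordinal lt_n.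
apply: contraNT nz => notin; apply/eqP/(orbit_e_eq0 (k := k)) => //.
  by apply: sL; apply: contra notin; apply: (@widen_residues_sub _ 0).
move=> [l lt_ln] /= ltlm.
have := IHm l ltlm lt_ln; set il := i (Ordinal _) => mem_l.
have mem : il \in iter m widen_residues s by apply: widen_residues_sub mem_l.
move: notin; rewrite iterS !mem_cat !negb_or => /and3P[ne1 ne2 ne3]; split.
- by apply: contraNneq ne1 => <-.
- by apply: contra ne2 => /eqP->; apply: map_f.
- apply: contra ne3 => /eqP il_eq; have -> : i k = il - res e 1.
    by rewrite il_eq addrK.
  exact: map_f.
Qed.
End FiniteSupport.

Lemma KLR_finite_support (R : comNzRingType) (e n r : nat)
    (j : 'I_r -> residue e) :
  exists t : seq {fset (residue e ^ n)},
    forall (x : KLR R n (weight_sum j)) (O : perm_orbit n (residue e)),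
      orbit_set O \notin t -> x O = 0.
Proof.
pose B := iter n (@widen_residues e) (codom j).
exists [seq place_orbit [ffun k => val (f k)] | f : {ffun 'I_n -> seq_sub B}].
move=> x O Ot; rewrite -[x O]mul1r.
suff -> : 1 = 0 :> KLR_orbit R (weight_sum j) O by rewrite mul0r.
have <- : quot_proj (relator (weight_sum j) (O := O)) 1 = 1 :> KLR_orbit R _ O.
  exact: rmorph1.
rewrite -(KLR_relP (@rel_sum R _ _ _ O)) rmorph_sum big_seq big1 //= => i Oi.
apply/eqP; apply: contraNT Ot => nz.
have sL a : a \notin codom j -> weight_sum j a = 0%N.
  move=> aj; rewrite /weight_sum big1 // => b _; rewrite /fundamental.
  by case: eqP => // ab; rewrite -ab codom_f in aj.
have iB := orbit_e_neq0 sL Oi nz.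
apply/mapP; exists [ffun k => SeqSub (iB k)]; first by rewrite mem_enum.
rewrite (mem_orbit Oi); congr place_orbit; apply/ffunP => k; by rewrite !ffunE.
Qed.

(* Main.v *)
Require Import Defs.
From mathcomp Require Import all_boot all_order all_algebra.
From mathcomp Require Import perm finmap boolp monalg.
From mathcomp Require Import zify ring.

Set Implicit Arguments.
Unset Strict Implicit.
Unset Printing Implicit Defensive.

Import Order.TTheory GRing.Theory Num.Theory.
Local Open Scope ring_scope.
Local Open Scope quotient_scope.

(** A letter is an index a of a summand of the weight; it stands for a one-column
    component whose first box has residue j_a.  A word w of length n adds n boxes
    one by one, box p going to the bottom of the column w_p, so that it has residue
    j_(w_p) minus the number of earlier occurrences of the letter w_p.  Both
    directions compare the idempotents e(i) with the residue sequences of words.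

    Close components.  Suppose that two starts A and B = A - d satisfy d < n.
    The algebra is deformed: on functions on the words in A and B, with values in
    the fraction field of R[t], let y_p multiply by t at the words with p-th letter B
    and by 0 at the others, and let psi_k exchange the letters k and k+1, as a divided
    difference or with a factor y_k - y_(k+1) when the residues ask for it.  All the
    relations hold, except that y_1 e(i) = 0 only holds modulo t.  The functions that
    are integral polynomials in the y's on each residue class form a stable lattice,
    and reducing it modulo t gives a module over the Temperley-Lieb quotient.  The
    words A^n and A^d B^(n-d) have the same residue sequence i.  A semisimple ring is
    von Neumann regular ([semisimple_regular]), so x = y_(d+1) e(i) would satisfy
    x z x = x for some z.  Apply this to the function 1 on the class of i.  Functions
    that vanish at A^n are stable, because no psi_k leads into A^n from another word; so
    z x 1 vanishes at A^n, and polynomials take congruent values modulo t at the two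
    words, so z x 1 is divisible by t at A^d B^(n-d), and x z x 1 lies in t times the
    lattice.  But x 1, which is t at one word and 0 at the other, does not
    ([not_regular], [TL_not_semisimple]).

    Separated components.  If all distances are at least n, then residues that occur
    in the columns of different letters within n boxes are neither equal nor
    adjacent.  Induction on prefixes shows that e(i) = 0 unless i is the residue
    sequence of a word with at most two letters, and that every y_p is zero
    ([E_neq0_word]).  Then psi_k e(i) is zero if the letters k and k+1 agree, and
    otherwise psi_k is invertible between e(i) and the idempotent of the swapped
    word.  Sorting a word by adjacent descents gives a path of psi's which does not depend
    on the descents chosen: with two letters, two descents are never neighbours,
    so they commute ([word_path_descent]).  The paths span the left ideals TL e(i) and
    are invertible, so these are simple or zero, and finitely many of them add up
    to the algebra ([semisimple_of_presentation]). *)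

(** * Semisimple rings are von Neumann regular *)

Section Regular.
Variable A : pzRingType.

Lemma left_ideal_sum (L M : A -> Prop) : left_ideal L -> left_ideal M ->
  left_ideal (fun x => exists u v, [/\ L u, M v & x = u + v]).
Proof.
move=> iL iM; split.
- by exists 0, 0; split; [apply: left_ideal_0 | apply: left_ideal_0 | rewrite addr0].
- move=> _ _ [u [v [Lu Mv ->]]] [u' [v' [Lu' Mv' ->]]].
  exists (u + u'), (v + v'); split; last by rewrite addrACA.
    exact: left_ideal_D.
  exact: left_ideal_D.
- move=> a _ [u [v [Lu Mv ->]]]; exists (a * u), (a * v).
  by split; [apply: left_ideal_M | apply: left_ideal_M | rewrite mulrDr].
Qed.

Lemma left_ideal_cap (L M : A -> Prop) : left_ideal L -> left_ideal M ->
  left_ideal (fun x => L x /\ M x).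
Proof.
move=> iL iM; split=> [|x y [? ?] [? ?]|a x [? ?]].
- by split; apply: left_ideal_0.
- by split; apply: left_ideal_D.
- by split; apply: left_ideal_M.
Qed.

Lemma left_idealB (L : A -> Prop) x y : left_ideal L -> L x -> L y -> L (x - y).
Proof.
by move=> iL Lx Ly; rewrite -mulN1r; apply: left_ideal_D => //; apply: left_ideal_M.
Qed.

(** Greedy choice: the simple summands are visited one by one, and a summand joins
    the complement unless it lies in the sum of M and the part built so far; by
    simplicity it then meets this sum trivially. *)
Lemma semisimple_complement (M : A -> Prop) : semisimple A -> left_ideal M ->
  exists C, [/\ left_ideal C, (forall x, M x -> C x -> x = 0) &
    forall a, exists u v, [/\ M u, C v & a = u + v]].
Proof.
move=> [m [L [simL decL]]] iM.
suff [C [iC MC0 LMC]] : exists C, [/\ left_ideal C,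
    (forall x, M x -> C x -> x = 0) &
    forall k, k \in enum 'I_m ->
      forall x, L k x -> exists u v, [/\ M u, C v & x = u + v]].
  exists C; split=> // a; have [x [[Lx ->] _]] := decL a.
  have iMC := left_ideal_sum iM iC.
  elim/big_ind: _ => [|b c|k _].
  - exact: (left_ideal_0 iMC).
  - exact: (left_ideal_D iMC).
  - by apply: (LMC k) => //; rewrite mem_enum.
elim: (enum _) => [|k s [C [iC MC0 LMC]]].
  exists (fun x => x = 0); split=> //.
  by split=> [//|x y -> ->|a x ->]; rewrite ?addr0 ?mulr0.
have [iL _ minL] := simL k.
have iMC := left_ideal_sum iM iC.
case: (minL _ (left_ideal_cap iL iMC)) => [x []//|capL0|subL].
- exists (fun x => exists u v, [/\ C u, L k v & x = u + v]); split.
  + exact: left_ideal_sum.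
  + move=> x Mx [u [v [Cu Lv def_x]]].
    have v0 : v = 0.
      apply: capL0; split=> //; exists x, (- u); split=> //.
        by rewrite -sub0r; apply: left_idealB => //; apply: left_ideal_0.
      by rewrite def_x addrAC subrr add0r.
    by apply: MC0 => //; rewrite def_x v0 addr0.
  + move=> l; rewrite inE => /predU1P[->|ls] x Lx.
      exists 0, x; split; [exact: left_ideal_0|exists 0, x; split=> //|by rewrite add0r].
        exact: left_ideal_0.
      by rewrite add0r.
    have [u [v [Mu Cv ->]]] := LMC l ls x Lx; exists u, v; split=> //.
    by exists v, 0; split=> //; [apply: left_ideal_0 | rewrite addr0].
- exists C; split=> // l; rewrite inE => /predU1P[->|ls] x Lx; last exact: (LMC l).
  by have [] := subL x Lx.
Qed.

(** Write 1 = z x + v with v in a complement C of the left ideal A x.  Then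
    x - x z x = x v lies both in A x and in C. *)
Lemma semisimple_regular : semisimple A -> forall x : A, exists z, x * z * x = x.
Proof.
move=> ssA x.
have iM : left_ideal (fun y => exists z, y = z * x).
  split=> [|_ _ [z ->] [z' ->]|a _ [z ->]].
  - by exists 0; rewrite mul0r.
  - by exists (z + z'); rewrite mulrDl.
  - by exists (a * z); rewrite mulrA.
have [C [iC MC0 decA]] := semisimple_complement ssA iM.
have [_ [v [[z ->] Cv def1]]] := decA 1.
exists z; apply/esym/eqP; rewrite -subr_eq0; apply/eqP/MC0.
  by exists (1 - x * z); rewrite mulrBl mul1r.
have -> : x - x * z * x = x * v.
  by rewrite -[X in X - _]mulr1 def1 mulrDr mulrA addrAC subrr add0r.
exact: left_ideal_M.
Qed.
End Regular.

(** * Words and their residues *)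

Section Words.
Variables (e n : nat) (X : finType) (start : X -> residue e).
Implicit Types (w : X ^ n).

Lemma resD x y : res e (x + y) = res e x + res e y.
Proof. by rewrite /res; rewrite pi_addr. Qed.
Lemma resN x : res e (- x) = - res e x.
Proof. by rewrite /res; rewrite pi_oppr. Qed.
Lemma resB x y : res e (x - y) = res e x - res e y.
Proof. by rewrite resD resN. Qed.
Lemma res0 : res e 0 = 0.
Proof. by rewrite -[0 in LHS](subrr 0) resB subrr. Qed.

Definition occ_before w (p : 'I_n) := #|[set s : 'I_n | (s < p)%N & w s == w p]|.

(** A box goes below the boxes that its column already contains, so its residue is the
    start of the column minus their number. *)
Definition word_residues w : residue e ^ n :=
  [ffun p => start (w p) - res e (occ_before w p)%:Z].

Definition swap_perm (k : 'I_n.-1) : 'S_n := tperm (pos k) (pos_next k).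

Lemma pos_neq (k : 'I_n.-1) : pos k != pos_next k.
Proof. by rewrite -val_eqE /= ltn_eqF. Qed.

Lemma place_swapE (T : choiceType) k (i : T ^ n) p : place_swap k i p = i (swap_perm k p).
Proof. by rewrite ffunE tpermV. Qed.

Lemma place_swapL (T : choiceType) k (i : T ^ n) : place_swap k i (pos k) = i (pos_next k).
Proof. by rewrite place_swapE tpermL. Qed.

Lemma place_swapR (T : choiceType) k (i : T ^ n) : place_swap k i (pos_next k) = i (pos k).
Proof. by rewrite place_swapE tpermR. Qed.

Lemma place_swapD (T : choiceType) k (i : T ^ n) p : p != pos k -> p != pos_next k ->
  place_swap k i p = i p.
Proof. by move=> pk pk'; rewrite place_swapE tpermD // eq_sym. Qed.

Lemma place_swapK (T : choiceType) k : involutive (@place_swap n T k).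
Proof. by move=> i; apply/ffunP => p; rewrite !place_swapE tpermK. Qed.

Lemma place_swap_id (T : choiceType) k (i : T ^ n) : i (pos k) = i (pos_next k) ->
  place_swap k i = i.
Proof.
by move=> ik; apply/ffunP => p; rewrite place_swapE /swap_perm; case: tpermP => [->|->|].
Qed.

Lemma occ_before_le w p : (occ_before w p <= p)%N.
Proof.
rewrite /occ_before -[X in (_ <= X)%N](size_iota 0) cardE.
rewrite -(size_map val); apply: uniq_leq_size.
  by rewrite map_inj_uniq ?enum_uniq //; apply: val_inj.
by move=> _ /mapP[s + ->]; rewrite mem_enum inE mem_iota => /andP[].
Qed.

Lemma eq_occ_before w w' (p : 'I_n) : (forall s : 'I_n, (s <= p)%N -> w s = w' s) ->
  occ_before w p = occ_before w' p.
Proof.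
move=> ww; apply: eq_card => s; rewrite !inE; case: ltnP => //= sp.
by rewrite !ww // ltnW.
Qed.

Lemma occ_before_next w k : w (pos k) = w (pos_next k) ->
  occ_before w (pos_next k) = (occ_before w (pos k)).+1.
Proof.
move=> wk; rewrite /occ_before (cardsD1 (pos k)) inE /= leqnn wk eqxx add1n; congr _.+1.
apply: eq_card => s; rewrite !inE ltnS leq_eqVlt -val_eqE /=.
by case: eqP => //= ->; rewrite ltnn.
Qed.

Lemma occ_before_swap w k p : w (pos k) != w (pos_next k) ->
  occ_before (place_swap k w) p = occ_before w (swap_perm k p).
Proof.
move=> wk; rewrite /occ_before.
rewrite -[RHS](card_imset _ (@perm_inj _ (swap_perm k))); apply: eq_card => s.
rewrite -[s](tpermK (pos k) (pos_next k)) -/(swap_perm k); set s' := swap_perm k s.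
rewrite mem_imset; last exact: perm_inj.
rewrite !inE !place_swapE -/s' {2}/swap_perm tpermK.
case: eqP => ws; last by rewrite !andbF.
rewrite !andbT.
have nkE (q : 'I_n) : nat_of_ord (swap_perm k q) =
    if q == k :> nat then k.+1 else if q == k.+1 :> nat then k : nat else q.
  rewrite /swap_perm; case: tpermP => [->|->|/eqP + /eqP] /=;
    rewrite ?eqxx ?(gtn_eqF (ltnSn k)) //.
  by rewrite -!val_eqE /= => /negPf-> /negPf->.
have spk : ~~ ((nat_of_ord s' == k) && (nat_of_ord (swap_perm k p) == k.+1)).
  apply/negP => /andP[/eqP s'k /eqP pk].
  have e1 : s' = pos k by apply: val_inj.
  have e2 : swap_perm k p = pos_next k by apply: val_inj.
  by move: wk; rewrite -e1 -e2 ws eqxx.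
have spk' : ~~ ((nat_of_ord s' == k.+1) && (nat_of_ord (swap_perm k p) == k)).
  apply/negP => /andP[/eqP s'k /eqP pk].
  have e1 : s' = pos_next k by apply: val_inj.
  have e2 : swap_perm k p = pos k by apply: val_inj.
  by move: wk; rewrite -e1 -e2 ws eqxx.
have -> : nat_of_ord p = swap_perm k (swap_perm k p) by rewrite tpermK.
have -> : nat_of_ord s = swap_perm k s' by rewrite tpermK.
move: spk spk'; rewrite (nkE s') (nkE (swap_perm k p)).
move: s' (swap_perm k p) => [x _] [y _] /=; move: (nat_of_ord k) => c.
by case: (x =P c); case: (x =P c.+1); case: (y =P c); case: (y =P c.+1) => /=; lia.
Qed.

(** Two different adjacent letters fill different columns, so the order in which they
    do so does not change the residue of either box. *)
Lemma word_residues_swap w k : w (pos k) != w (pos_next k) ->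
  word_residues (place_swap k w) = place_swap k (word_residues w).
Proof.
move=> wk; apply/ffunP => p.
by rewrite place_swapE !ffunE tpermV (occ_before_swap _ wk).
Qed.
End Words.

Lemma place_swap_comm n (T : choiceType) (k l : 'I_n.-1) (x : T ^ n) : k.+1 != l ->
  l.+1 != k ->
  place_swap k (place_swap l x) = place_swap l (place_swap k x).
Proof.
have [->//|kl] := eqVneq k l; move=> kl1 lk1.
have kl' : k != l :> nat by [].
have [p1 p2 p3 p4] : [/\ pos k != pos l, pos k != pos_next l,
    pos_next k != pos l & pos_next k != pos_next l].
  by split; rewrite -val_eqE //= 1?eq_sym.
apply/ffunP => p; have [->|pk] := eqVneq p (pos k).
  by rewrite place_swapL (place_swapD _ p3 p4) (place_swapD _ p1 p2) place_swapL.
have [->|pk'] := eqVneq p (pos_next k).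
  by rewrite place_swapR (place_swapD _ p1 p2) (place_swapD _ p3 p4) place_swapR.
rewrite place_swapD //; have [->|pl] := eqVneq p (pos l).
  by rewrite !place_swapL place_swapD // eq_sym.
have [->|pl'] := eqVneq p (pos_next l).
  by rewrite !place_swapR place_swapD // eq_sym.
by rewrite !place_swapD.
Qed.

(** * Operators on functions of two-letter words *)

Section SmallResidues.
Variable e : nat.
Hypothesis res_small : forall z : int, res e z = 0 -> z = 0 \/ (3 < `|z|)%N.
Local Notation "1r" := (res e 1).
Implicit Types a b : residue e.

Lemma arrow_sub a : arrow (a - 1r) a.
Proof. by rewrite /arrow subrK. Qed.

Lemma res_nat_neq0 m : (0 < m)%N -> (m <= 3)%N -> res e m%:Z != 0.
Proof. by move=> ? ?; apply/eqP => /res_small; lia. Qed.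

Lemma res2_neq0 : 1r + 1r != 0.
Proof. by rewrite -resD (@res_nat_neq0 2). Qed.
Lemma res1_neq0 : 1r != 0.
Proof. by rewrite (@res_nat_neq0 1). Qed.

Lemma arrow_subF a : arrow a (a - 1r) = false.
Proof.
apply/negbTE; rewrite /arrow -subr_eq0.
have -> : a - 1r - (a + 1r) = - (1r + 1r) by rewrite opprD addrACA subrr add0r opprD.
by rewrite oppr_eq0 res2_neq0.
Qed.

Lemma sub1_neq a : (a == a - 1r) = false.
Proof. by rewrite -subr_eq0 opprB addrC subrK (negPf res1_neq0). Qed.

Lemma arrow_sym a b : arrow a b -> arrow b a = false.
Proof. by rewrite {1}/arrow => /eqP->; rewrite -[a in arrow _ a](addrK 1r) arrow_subF. Qed.

End SmallResidues.

Section Model.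
Variables (K : fieldType) (t : K) (e n : nat) (A B : residue e).
Hypothesis t_neq0 : t != 0.
Hypothesis res_small : forall z : int, res e z = 0 -> z = 0 \/ (3 < `|z|)%N.

Local Notation start := (fun b : bool => if b then B else A).
Local Notation word := (bool ^ n)%type.
Local Notation residues := (@word_residues e n bool start).
Local Notation "1r" := (res e 1).
Implicit Types (w : word) (f : {ffun word -> K}) (k l : 'I_n.-1).

(** The deformation: the values 0 and t of y tell the two columns apart. *)
Definition xval (b : bool) : K := if b then t else 0.

(** [diag_coef] and [swap_coef] are the coefficients of f(w) and f(s_k w) in
    (psi_k f)(w), for a word w with letters u, v and residues a, b at k and k+1.
    Equal residues give the divided difference.  The residues of two boxes of the
    same column are c and c - 1; the factor y_k - y_(k+1) is put on this side of the
    arrow because it vanishes at such words, which have no swapped partner. *)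
Definition diag_coef (u v : bool) (a b : residue e) : K :=
  if (u != v) && (a == b) then (xval v - xval u)^-1 else 0.
Definition swap_coef (u v : bool) (a b : residue e) : K :=
  if u == v then 0 else if a == b then - (xval v - xval u)^-1
  else if arrow b a then xval u - xval v else 1.

Definition op_psi k f : {ffun word -> K} := [ffun w : word =>
  diag_coef (w (pos k)) (w (pos_next k)) (residues w (pos k)) (residues w (pos_next k))
    * f w +
  swap_coef (w (pos k)) (w (pos_next k)) (residues w (pos k)) (residues w (pos_next k))
    * f (place_swap k w)].
Definition op_y p f : {ffun word -> K} := [ffun w : word => xval (w p) * f w].
Definition op_e i f : {ffun word -> K} :=
  [ffun w : word => if residues w == i then f w else 0].

Lemma xvalB u v : u != v -> xval u - xval v != 0.
Proof. by case: u v => [] [] // _; rewrite /xval ?subr0 ?sub0r ?oppr_eq0. Qed.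

Lemma residue_next w k : w (pos k) = w (pos_next k) ->
  residues w (pos_next k) = residues w (pos k) - 1r.
Proof.
move=> wk; rewrite !ffunE occ_before_next // -addn1 PoszD resD -wk.
by rewrite opprD addrA.
Qed.

(** This is what keeps the functions that vanish at A...A stable. *)
Lemma op_psi_same k f w : w (pos k) = w (pos_next k) -> op_psi k f w = 0.
Proof. by move=> wk; rewrite ffunE /diag_coef /swap_coef wk eqxx /= !mul0r addr0. Qed.

Lemma op_psi_neq k f w : w (pos k) != w (pos_next k) ->
  op_psi k f w =
  (if residues w (pos k) == residues w (pos_next k)
   then (xval (w (pos_next k)) - xval (w (pos k)))^-1 * (f w - f (place_swap k w))
   else if arrow (residues w (pos_next k)) (residues w (pos k))
   then (xval (w (pos k)) - xval (w (pos_next k))) * f (place_swap k w)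
   else f (place_swap k w)).
Proof.
move=> wk; rewrite ffunE /diag_coef /swap_coef wk (negPf wk) /=.
by do 2?case: ifP => _; ring.
Qed.

Lemma op_psi_e k i f : op_psi k (op_e i f) = op_e (place_swap k i) (op_psi k f).
Proof.
apply/ffunP => w; rewrite [RHS]ffunE.
have [wk|wk] := eqVneq (w (pos k)) (w (pos_next k)).
  by rewrite !op_psi_same // if_same.
rewrite !op_psi_neq // ![op_e _ _ _]ffunE word_residues_swap //.
have swE : (place_swap k (residues w) == i) = (residues w == place_swap k i).
  by rewrite -(inj_eq (can_inj (@place_swapK _ _ k))) place_swapK.
case: eqP => [wE|_]; last by rewrite swE; case: (residues w == _) => //;
  rewrite mulr0 if_same.
by rewrite -swE place_swap_id //; case: ifP; rewrite // subrr mulr0.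
Qed.

Lemma op_eK i f w : residues w = i -> op_e i f w = f w.
Proof. by move=> wi; rewrite ffunE wi eqxx. Qed.

Lemma op_y_e p i f : op_e i (op_y p f) = op_y p (op_e i f).
Proof. by apply/ffunP => w; rewrite !ffunE; case: ifP; rewrite ?mulr0. Qed.

Lemma op_ee i j f : op_e i (op_e j f) = if i == j then op_e i f else 0.
Proof.
apply/ffunP => w; rewrite (fun_if (fun g : {ffun word -> K} => g w)) !ffunE.
have [<-|ij] := eqVneq i j; first by case: eqP.
by case: eqP => [->|_]; rewrite ?(negPf ij).
Qed.

Lemma op_yy p q f : op_y p (op_y q f) = op_y q (op_y p f).
Proof. by apply/ffunP => w; rewrite !ffunE mulrCA. Qed.

Lemma op_psi_y k p f : p != pos k -> p != pos_next k ->
  op_psi k (op_y p f) = op_y p (op_psi k f).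
Proof.
move=> pk pk'; apply/ffunP => w.
rewrite ![op_psi _ _ _]ffunE ![op_y _ _ _]ffunE place_swapD //.
by rewrite [op_psi _ _ _]ffunE; ring.
Qed.

Lemma op_e_supp i f w : residues w != i -> op_e i f w = 0.
Proof. by move=> wi; rewrite ffunE (negPf wi). Qed.

Lemma op_psi_y_next k i f :
  op_psi k (op_y (pos_next k) (op_e i f)) =
  op_y (pos k) (op_psi k (op_e i f)) + op_e i f *+ (i (pos k) == i (pos_next k)).
Proof.
apply/ffunP => w; set F := op_e i f; rewrite [RHS]ffunE ffunMnE [op_y _ _ w]ffunE.
have [wk|wk] := eqVneq (w (pos k)) (w (pos_next k)).
  rewrite !op_psi_same // mulr0 add0r.
  have [wi|/op_e_supp->] := eqVneq (residues w) i; last by rewrite mul0rn.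
  by rewrite -wi (residue_next wk) (sub1_neq res_small) mulr0n.
rewrite !op_psi_neq // [op_y _ _ w]ffunE [op_y _ _ (place_swap k w)]ffunE place_swapR.
have x0 : xval (w (pos_next k)) - xval (w (pos k)) != 0 by rewrite xvalB // eq_sym.
have [wi|wi] := eqVneq (residues w) i.
  rewrite wi; case: eqP => _; rewrite ?mulr1n ?mulr0n; last by case: ifP => _; ring.
  by field.
rewrite [F w]op_e_supp // mul0rn.
case: eqP => [wE|_]; last by case: ifP => _; ring.
suff -> : F (place_swap k w) = 0 by rewrite !(mulr0, subrr, addr0).
by rewrite [LHS]op_e_supp // word_residues_swap // place_swap_id.
Qed.

Lemma op_y_next_psi k i f :
  op_y (pos_next k) (op_psi k (op_e i f)) =
  op_psi k (op_y (pos k) (op_e i f)) + op_e i f *+ (i (pos k) == i (pos_next k)).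
Proof.
apply/ffunP => w; set F := op_e i f; rewrite [RHS]ffunE ffunMnE [op_y _ _ w]ffunE.
have [wk|wk] := eqVneq (w (pos k)) (w (pos_next k)).
  rewrite !op_psi_same // mulr0 add0r.
  have [wi|/op_e_supp->] := eqVneq (residues w) i; last by rewrite mul0rn.
  by rewrite -wi (residue_next wk) (sub1_neq res_small) mulr0n.
rewrite !op_psi_neq // [op_y _ _ w]ffunE [op_y _ _ (place_swap k w)]ffunE place_swapL.
have x0 : xval (w (pos_next k)) - xval (w (pos k)) != 0 by rewrite xvalB // eq_sym.
have [wi|wi] := eqVneq (residues w) i.
  rewrite wi; case: eqP => _; rewrite ?mulr1n ?mulr0n; last by case: ifP => _; ring.
  by field.
rewrite [F w]op_e_supp // mul0rn.
case: eqP => [wE|_]; last by case: ifP => _; ring.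
suff -> : F (place_swap k w) = 0 by rewrite !(mulr0, subrr, addr0).
by rewrite [LHS]op_e_supp // word_residues_swap // place_swap_id.
Qed.

Lemma place_swap_letter k w : (place_swap k w (pos k) == place_swap k w (pos_next k)) =
  (w (pos k) == w (pos_next k)).
Proof. by rewrite place_swapL place_swapR eq_sym. Qed.

Lemma op_psi_square k f w :
  op_psi k (op_psi k f) w =
    let a := residues w (pos k) in let b := residues w (pos_next k) in
    if a == b then 0
    else if arrow a b then (xval (w (pos_next k)) - xval (w (pos k))) * f w
    else if arrow b a then (xval (w (pos k)) - xval (w (pos_next k))) * f w
    else f w.
Proof.
move=> /=; have [wk|wk] := eqVneq (w (pos k)) (w (pos_next k)).
  rewrite op_psi_same // residue_next // (sub1_neq res_small) (arrow_subF res_small)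
    arrow_sub wk.
  by rewrite subrr mul0r.
have wk' : place_swap k w (pos k) != place_swap k w (pos_next k) by rewrite
  place_swap_letter.
have x0 : xval (w (pos_next k)) - xval (w (pos k)) != 0 by rewrite xvalB // eq_sym.
have x0' : xval (w (pos k)) - xval (w (pos_next k)) != 0 by rewrite xvalB // eq_sym.
rewrite op_psi_neq // (op_psi_neq f wk) (op_psi_neq f wk') place_swapK.
rewrite !place_swapL !place_swapR word_residues_swap // place_swapL place_swapR.
rewrite [residues w (pos_next k) == _]eq_sym.
case: eqP => _; first by field; apply/andP.
case: (boolP (arrow (residues w (pos k)) _)) => [/(arrow_sym res_small)-> //|_].
by case: ifP.
Qed.

Lemma op_psi_comm k l f : k.+1 != l -> l.+1 != k ->
  op_psi k (op_psi l f) = op_psi l (op_psi k f).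
Proof.
have [->//|kl] := eqVneq k l; move=> kl1 lk1.
have kl' : k != l :> nat by [].
have pD : [/\ pos k != pos l, pos k != pos_next l, pos_next k != pos l & pos_next k !=
  pos_next l].
  by split; rewrite -val_eqE //= 1?eq_sym.
case: pD => [p1 p2 p3 p4].
apply/ffunP => w; rewrite ![op_psi _ _ _]ffunE.
have swC := place_swap_comm w kl1 lk1.
have [q1 q2 q3 q4] : [/\ pos l != pos k, pos l != pos_next k,
    pos_next l != pos k & pos_next l != pos_next k] by split; rewrite eq_sym.
rewrite (place_swapD w p1 p2) (place_swapD w p3 p4) (place_swapD w q1 q2) (place_swapD w q3
  q4) swC.
have [wl|wl] := eqVneq (w (pos l)) (w (pos_next l)).
  by rewrite /diag_coef /swap_coef !wl !eqxx /= !(mul0r, addr0, mulr0).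
have [wk|wk] := eqVneq (w (pos k)) (w (pos_next k)).
  by rewrite /diag_coef /swap_coef !wk !eqxx /= !(mul0r, addr0, mulr0).
rewrite !word_residues_swap // (place_swapD _ p1 p2) (place_swapD _ p3 p4).
by rewrite (place_swapD _ q1 q2) (place_swapD _ q3 q4); ring.
Qed.

Section Braid.
Variables (k l : 'I_n.-1) (lk : l = k.+1 :> nat).

Lemma pos_chain : pos_next k = pos l.
Proof. exact: val_inj. Qed.

(** In a block of letters u, v, u the swaps reach the three words uvu, uuv and vuu
    only; their residues are determined by a and b. *)
Lemma op_psi_pattern w : w (pos k) != w (pos l) -> w (pos_next l) = w (pos k) ->
  let u := w (pos k) in let v := w (pos l) in
  let a := residues w (pos k) in let b := residues w (pos l) in
  [/\ (forall f, op_psi k f w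
                  = diag_coef u v a b * f w + swap_coef u v a b * f (place_swap k w)),
      (forall f, op_psi l f w = diag_coef v u b (a - 1r) * f w
                                + swap_coef v u b (a - 1r) * f (place_swap l w)),
      (forall f, op_psi k f (place_swap l w) = 0),
      (forall f, op_psi l f (place_swap k w) = 0) &
      (forall f, op_psi k f (place_swap k w) =
         diag_coef v u b a * f (place_swap k w) + swap_coef v u b a * f w) /\
      (forall f, op_psi l f (place_swap l w) =
         diag_coef u v (a - 1r) b * f (place_swap l w) + swap_coef u v (a - 1r) b * f w)].
Proof.
move=> uv wl u v a b.
have kl1 : pos k != pos_next l by rewrite -val_eqE /= lk; lia.
have kl : pos k != pos l by rewrite -pos_chain pos_neq.
have lk1 : pos_next l != pos k by rewrite eq_sym.
have ll : pos_next l != pos l by rewrite eq_sym pos_neq.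
have lk2 : pos_next l != pos_next k by rewrite pos_chain.
have uv' : w (pos l) != w (pos_next l) by rewrite wl eq_sym.
have uvk : w (pos k) != w (pos_next k) by rewrite pos_chain.
have def_c : residues w (pos_next l) = a - 1r.
  have sl : place_swap k w (pos l) = place_swap k w (pos_next l).
    by rewrite -{1}pos_chain place_swapR place_swapD.
  have := residue_next sl;
    rewrite word_residues_swap // -[pos l]pos_chain place_swapR place_swapD //.
split; try split; move=> f.
- by rewrite ffunE pos_chain.
- by rewrite ffunE wl def_c.
- by apply: op_psi_same; rewrite pos_chain place_swapL place_swapD.
- by apply: op_psi_same; rewrite -{1}pos_chain place_swapR place_swapD.
- by rewrite ffunE place_swapK word_residues_swap // !place_swapL !place_swapR pos_chain.
- by rewrite ffunE place_swapK word_residues_swap // !place_swapL !place_swapR def_c wl.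
Qed.

Definition braid_defect f w : K :=
  op_psi k (op_psi l (op_psi k f)) w - op_psi l (op_psi k (op_psi l f)) w.

(** The error term of the braid relation appears at the two outer words of the block,
    when the residue of the single letter equals one of the residues of the double
    letter. *)
Lemma op_psi_braid_pattern w f : w (pos k) != w (pos l) -> w (pos_next l) = w (pos k) ->
  [/\ braid_defect f w = 0,
      braid_defect f (place_swap l w) =
        if residues w (pos l) == residues w (pos k) then - f (place_swap l w) else 0 &
      braid_defect f (place_swap k w) =
        if residues w (pos l) == residues w (pos k) - 1r then f (place_swap k w) else 0].
Proof.
move=> uv wl; have := op_psi_pattern uv wl => /=.
set w1 := place_swap l w; set w3 := place_swap k w.
move: (residues w (pos k) : residue e) (residues w (pos l) : residue e) => a b.
move: (w (pos k)) (w (pos l)) uv => u v uv [E1 E2 E3 E4 [E5 E6]].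
have x0 : xval v - xval u != 0 by rewrite xvalB // eq_sym.
have x1 : xval u - xval v != 0 by rewrite xvalB.
rewrite /braid_defect !(E1, E2, E3, E4, E5, E6) /diag_coef /swap_coef.
rewrite uv (eq_sym v u) uv (negPf uv) /=.
have [ba|ba] := eqVneq b a.
  by rewrite ba ?eqxx ?(sub1_neq res_small) ?arrow_sub ?(arrow_subF res_small) ?(eq_sym (a
    - 1r)) ?(sub1_neq res_small) /=; split; field; rewrite ?x0 ?x1.
have [ba'|ba'] := eqVneq b (a - 1r).
  rewrite ba' ?eqxx ?(sub1_neq res_small) ?arrow_sub ?(arrow_subF res_small) ?(eq_sym (a -
    1r)) ?(sub1_neq res_small) /=.
  by split; field; rewrite ?x0 ?x1.
have -> : arrow b a = false by rewrite /arrow -subr_eq eq_sym (negPf ba').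
have -> : arrow (a - 1r) b = false by rewrite /arrow subrK (negPf ba).
by split; ring.
Qed.

(** Three positions carry only two letters, so two of them agree; if all three agree
    both sides vanish, and otherwise the block is a rearrangement of u, v, u. *)
Lemma op_psi_braid f w :
  braid_defect f w =
    let a := residues w (pos k) in let b := residues w (pos l) in let c := residues w
      (pos_next l) in
    if (c == a) && arrow a b then f w
    else if (c == a) && arrow b a then - f w
    else 0.
Proof.
have kl1 : pos k != pos_next l by rewrite -val_eqE /= lk; lia.
have kl : pos k != pos l by rewrite -pos_chain pos_neq.
have lk1 : pos_next l != pos k by rewrite eq_sym.
have lk2 : pos_next l != pos_next k by rewrite pos_chain eq_sym pos_neq.
have next_k : w (pos k) = w (pos l) -> residues w (pos l) = residues w (pos k) - 1r.
  by rewrite -pos_chain; apply: residue_next.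
have next_l : w (pos l) = w (pos_next l) ->
  residues w (pos_next l) = residues w (pos l) - 1r.
  exact: residue_next.
have [kl_w|kl_w] /= := eqVneq (w (pos k)) (w (pos l)).
  have [ll_w|ll_w] := eqVneq (w (pos l)) (w (pos_next l)).
    rewrite /braid_defect !op_psi_same ?pos_chain // subrr next_l // next_k //.
    rewrite -addrA -opprD -subr_eq0 addrAC subrr sub0r oppr_eq0.
    by rewrite (negPf (res2_neq0 res_small)).
  have uv : place_swap l w (pos k) != place_swap l w (pos l).
    by rewrite place_swapL place_swapD // kl_w.
  have wl : place_swap l w (pos_next l) = place_swap l w (pos k).
    by rewrite place_swapR place_swapD.
  have [_ + _] := op_psi_braid_pattern f uv wl.
  rewrite place_swapK => ->; rewrite word_residues_swap // place_swapL place_swapD //.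
  by rewrite next_k // (arrow_subF res_small) arrow_sub andbF andbT.
have [ll_w|ll_w] := eqVneq (w (pos l)) (w (pos_next l)).
  have uv : place_swap k w (pos k) != place_swap k w (pos l).
    by rewrite place_swapL -[pos l]pos_chain place_swapR pos_chain eq_sym.
  have wl : place_swap k w (pos_next l) = place_swap k w (pos k).
    by rewrite place_swapL place_swapD // pos_chain.
  have [_ _] := op_psi_braid_pattern f uv wl.
  rewrite place_swapK => ->; rewrite word_residues_swap ?pos_chain //.
  rewrite place_swapL -[pos l]pos_chain place_swapR pos_chain next_l //.
  have -> : arrow (residues w (pos k)) (residues w (pos l)) = (residues w (pos k) ==
    residues w (pos l) - 1r).
    by rewrite /arrow -subr_eq eq_sym.
  by case: eqVneq.
have wl : w (pos_next l) = w (pos k).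
  by move: kl_w ll_w; case: (w (pos k)) (w (pos l)) (w (pos_next l)) => [] [] [].
have [-> _ _] := op_psi_braid_pattern f kl_w wl.
have wk : w (pos k) != w (pos_next k) by rewrite pos_chain.
have sl : place_swap k w (pos_next k) = place_swap k w (pos_next l).
  by rewrite place_swapR place_swapD.
have := residue_next (k := l) (w := place_swap k w); rewrite -pos_chain => /(_ sl).
rewrite word_residues_swap // place_swapR place_swapD // => ->.
by rewrite eq_sym (sub1_neq res_small).
Qed.
End Braid.
End Model.

(** * The action of the free algebra *)

(** Both sides of the braid relation reverse three consecutive positions. *)
Section ReverseThree.
Variables (n : nat) (T : choiceType) (k l : 'I_n.-1) (lk : l = k.+1 :> nat).

Lemma place_swap_klk (x : T ^ n) p :
  place_swap k (place_swap l (place_swap k x)) p = x (tperm (pos k) (pos_next l) p).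
Proof.
have kl1 : pos k != pos_next l by rewrite -val_eqE /= lk; lia.
have kl : pos l = pos_next k by apply: val_inj.
have k1l1 : pos_next k != pos_next l by rewrite -kl pos_neq.
rewrite !place_swapE /swap_perm kl; congr (x _).
have k01 := pos_neq k.
case: (tpermP (pos k) (pos_next l) p) => [->|->|/eqP pk /eqP pl].
- by rewrite tpermL tpermL tpermD // eq_sym.
- by rewrite (tpermD kl1 k1l1) tpermR tpermR.
have [->|pk1] := eqVneq p (pos_next k).
  by rewrite tpermR (tpermD (x := pos_next k)) ?tpermL // eq_sym.
by rewrite !tpermD // eq_sym.
Qed.

Lemma place_swap_lkl (x : T ^ n) :
  place_swap l (place_swap k (place_swap l x)) = place_swap k (place_swap l (place_swap k
    x)).
Proof.
have kl1 : pos k != pos_next l by rewrite -val_eqE /= lk; lia.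
have kl : pos l = pos_next k by apply: val_inj.
have k1l1 : pos_next k != pos_next l by rewrite -kl pos_neq.
apply/ffunP => p; rewrite place_swap_klk !place_swapE /swap_perm kl; congr (x _).
have k01 := pos_neq k.
case: (tpermP (pos k) (pos_next l) p) => [->|->|/eqP pk /eqP pl].
- by rewrite (tpermD (z := pos k)) ?tpermL // eq_sym.
- by rewrite tpermR tpermR tpermD // eq_sym.
have [->|pk1] := eqVneq p (pos_next k).
  by rewrite tpermL (tpermD (z := pos_next l)) ?tpermR.
by rewrite !tpermD // eq_sym.
Qed.
End ReverseThree.

Section Action.
Variables (R K : fieldType) (phi : {rmorphism R -> K}) (t : K).
Variables (e n : nat) (A B : residue e).
Variable O : perm_orbit n (residue e).
Hypothesis t_neq0 : t != 0.
Hypothesis res_small : forall z : int, res e z = 0 -> z = 0 \/ (3 < `|z|)%N.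

Local Notation start := (fun b : bool => if b then B else A).
Local Notation word := (bool ^ n)%type.
Local Notation residues := (@word_residues e n bool start).
Local Notation V := {ffun word -> K}.
Local Notation free := (free_alg R O).
Implicit Types (f h : V) (a b : free) (g : generator O).

Definition gen_op g f : V :=
  match g with
  | Psi k => op_psi t A B k f
  | Y p => op_y t p f
  | E u => op_e A B (val u) f
  end.

Definition scale_fun (c : K) f : V := [ffun w => c * f w].

Lemma gen_opD g f h : gen_op g (f + h) = gen_op g f + gen_op g h.
Proof.
apply/ffunP => w; case: g => [k|p|u] /=; rewrite !ffunE ?mulrDr //.
  by rewrite addrACA.
by case: ifP => // _; rewrite addr0.
Qed.

Lemma gen_op_scale g c f : gen_op g (scale_fun c f) = scale_fun c (gen_op g f).
Proof.
apply/ffunP => w; case: g => [k|p|u] /=; rewrite !ffunE.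
- by rewrite mulrDr !(mulrCA c).
- by rewrite mulrCA.
- by case: ifP => // _; rewrite mulr0.
Qed.

Lemma scale_fun0 f : scale_fun 0 f = 0.
Proof. by apply/ffunP => w; rewrite !ffunE mul0r. Qed.
Lemma scale_fun1 f : scale_fun 1 f = f.
Proof. by apply/ffunP => w; rewrite !ffunE mul1r. Qed.

Lemma gen_op0 g : gen_op g 0 = 0.
Proof. by rewrite -(scale_fun0 0) gen_op_scale !scale_fun0. Qed.

Definition word_op (m : seq (generator O)) f : V := foldr gen_op f m.

Lemma word_op_sum m (I : eqType) (s : seq I) (c : I -> K) (F : I -> V) :
  word_op m (\sum_(x <- s) scale_fun (c x) (F x)) = \sum_(x <- s) scale_fun (c x) (word_op
    m (F x)).
Proof.
elim: m => [//|g m IHm] /=; rewrite IHm.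
elim: s {IHm} => [|x s IHs]; first by rewrite !big_nil gen_op0.
by rewrite !big_cons gen_opD gen_op_scale IHs.
Qed.

(** The action is the linear extension of the composites of generators: for fixed f and
    w it is a linear functional of the algebra element. *)
Definition act a f : V :=
  [ffun w => mmap phi (fun m : {fmonom generator O} => word_op m f w) a].

Lemma sum_ffunE (I : Type) (s : seq I) (F : I -> V) w :
  (\sum_(x <- s) F x) w = \sum_(x <- s) F x w.
Proof. by elim: s => [|x s IHs]; rewrite ?big_nil ?big_cons !ffunE ?IHs. Qed.

Lemma actE a f : act a f = \sum_(m <- msupp a) scale_fun (phi a@_m) (word_op m f).
Proof.
by apply/ffunP => w; rewrite ffunE sum_ffunE mmapE; apply: eq_bigr => m _; rewrite ffunE.
Qed.

Lemma actD a b f : act (a + b) f = act a f + act b f.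
Proof. by apply/ffunP => w; rewrite !ffunE mmapD. Qed.
Lemma actN a f : act (- a) f = - act a f.
Proof. by apply/ffunP => w; rewrite !ffunE mmapN. Qed.
Lemma actB a b f : act (a - b) f = act a f - act b f.
Proof. by rewrite actD actN. Qed.
Lemma act0 f : act 0 f = 0.
Proof. by rewrite -[0 in LHS](subrr 0) actB subrr. Qed.

Lemma actU c m f : act << c *g m >> f = scale_fun (phi c) (word_op m f).
Proof. by apply/ffunP => w; rewrite !ffunE mmapU. Qed.

Lemma act_sum (I : Type) (s : seq I) (F : I -> free) f :
  act (\sum_(x <- s) F x) f = \sum_(x <- s) act (F x) f.
Proof.
by elim: s => [|x s IHs]; rewrite ?big_nil ?act0 // !big_cons actD IHs.
Qed.

Lemma scale_fun_sum c (I : Type) (s : seq I) (F : I -> V) :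
  scale_fun c (\sum_(x <- s) F x) = \sum_(x <- s) scale_fun c (F x).
Proof.
apply/ffunP => w; rewrite ffunE !sum_ffunE mulr_sumr.
by apply: eq_bigr => x _; rewrite ffunE.
Qed.

Lemma actM a b f : act (a * b) f = act a (act b f).
Proof.
rewrite malgME act_sum actE; apply: eq_bigr => m1 _.
rewrite act_sum [act b f]actE word_op_sum scale_fun_sum; apply: eq_bigr => m2 _.
by rewrite actU fmM /word_op foldr_cat; apply/ffunP => w; rewrite !ffunE rmorphM mulrA.
Qed.

Lemma act1 f : act 1 f = f.
Proof. by rewrite actU rmorph1 scale_fun1 fm1. Qed.

Lemma act_gen g f : act (gen R g) f = gen_op g f.
Proof. by rewrite actU rmorph1 scale_fun1 fmU. Qed.

Lemma act_gen_e i f : act (gen_e R O i) f = if i \in orbit_set O then op_e A B i f else 0.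
Proof.
rewrite /gen_e; case: insubP => [u Oi uE|/negPf->]; last by rewrite act0.
by rewrite Oi act_gen /= uE.
Qed.

Lemma act_nat m f : act m%:R f = f *+ m.
Proof. by elim: m => [|m IHm];
  rewrite ?act0 // -addn1 natrD actD IHm act1 mulrnDr mulr1n. Qed.

Variable L : weight e.

Lemma act_yB p q i f w : i \in orbit_set O ->
  act ((gen R (Y O p) - gen R (Y O q)) * gen_e R O i) f w =
  (xval t (w p) - xval t (w q)) * op_e A B i f w.
Proof.
by move=> Oi; rewrite actM actB !act_gen act_gen_e Oi /= !ffunE mulrBl.
Qed.

Lemma act_triples a1 a2 a3 b1 b2 b3 f :
  act (a1 * a2 * a3 - b1 * b2 * b3) f =
  act a1 (act a2 (act a3 f)) - act b1 (act b2 (act b3 f)).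
Proof.
rewrite actB; congr (_ - _).
  by rewrite 2![LHS]actM.
by rewrite 2![LHS]actM.
Qed.

(** The cyclotomic relation and the sum of the idempotents are exceptional: on the
    lattice, the first holds modulo t, and the second holds for functions supported in
    the orbit. *)
Lemma act_rel (lhs rhs : free) : KLR_rel L lhs rhs ->
  [\/ act lhs =1 act rhs,
      exists (i : residue e ^ n) (k : 'I_n), [/\ i \in orbit_set O, k = 0%N :> nat &
        lhs = gen R (Y O k) ^+ L (i k) * gen_e R O i /\ rhs = 0] |
      lhs = \sum_(i <- orbit_set O) gen_e R O i /\ rhs = 1].
Proof.
have swO i k : i \in orbit_set O -> place_swap k i \in orbit_set O by apply: mem_place_swap.
case=> [i k Oi k0|i j Oi Oj||i k Oi|i k Oi|k l|k l|k l|i k Oi|i k Oi|i k Oi|i k l Oi lk].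
- by apply: Or32; exists i, k.
- apply: Or31 => f; rewrite actM !act_gen_e Oi Oj op_ee.
  by case: eqP => _; rewrite ?act0 ?act_gen_e ?Oi.
- exact: Or33.
- by apply: Or31 => f; rewrite [LHS]actM [RHS]actM !act_gen_e Oi !act_gen /= op_y_e.
- by apply: Or31 => f;
    rewrite [LHS]actM [RHS]actM !act_gen_e Oi swO // !act_gen /= op_psi_e.
- by apply: Or31 => f; rewrite [LHS]actM [RHS]actM !act_gen /= op_yy.
- by move=> lk lk'; apply: Or31 => f; rewrite [LHS]actM [RHS]actM !act_gen /= op_psi_y.
- by move=> lk lk'; apply: Or31 => f; rewrite [LHS]actM [RHS]actM !act_gen /= op_psi_comm.
- apply: Or31 => f; rewrite 2![LHS]actM [RHS]actM !act_gen_e Oi actD actM act_nat !act_gen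
    /=.
  by rewrite op_psi_y_next.
- apply: Or31 => f; rewrite 2![LHS]actM [RHS]actM !act_gen_e Oi actD actM act_nat !act_gen
    /=.
  by rewrite op_y_next_psi.
- apply: Or31 => f; rewrite expr2 !actM !act_gen_e Oi !act_gen /=.
  rewrite !op_psi_e place_swapK /psi_square; apply/ffunP => w.
  have [wi|wi] := eqVneq (residues w) i.
    rewrite op_eK // op_psi_square // wi /=.
    case: ifP => _; first by rewrite act0 ffunE.
    case: ifP => _; first by rewrite act_yB // op_eK.
    case: ifP => _; first by rewrite act_yB // op_eK.
    by rewrite act_gen_e Oi op_eK.
  rewrite op_e_supp //; case: ifP => _; first by rewrite act0 ffunE.
  case: ifP => _; first by rewrite act_yB // op_e_supp ?mulr0.
  case: ifP => _; first by rewrite act_yB // op_e_supp ?mulr0.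
  by rewrite act_gen_e Oi op_e_supp.
- apply: Or31 => f; rewrite [LHS]actM act_gen_e Oi act_triples !act_gen /=.
  rewrite !op_psi_e (place_swap_lkl lk); set i' := place_swap k _.
  have kl1 : pos l != pos k by rewrite -val_eqE /= lk; lia.
  have i1 : i' (pos k) = i (pos_next l) by rewrite (place_swap_klk lk) tpermL.
  have i2 : i' (pos l) = i (pos l) by rewrite (place_swap_klk lk) tpermD // eq_sym ?pos_neq.
  have i3 : i' (pos_next l) = i (pos k) by rewrite (place_swap_klk lk) tpermR.
  have ii' : i (pos_next l) = i (pos k) -> i' = i.
    by move=> ii; apply/ffunP => p; rewrite (place_swap_klk lk); case: tpermP => [->|->|].
  have -> : op_e A B i' (op_psi t A B k (op_psi t A B l (op_psi t A B k f))) -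
    op_e A B i' (op_psi t A B l (op_psi t A B k (op_psi t A B l f))) =
    op_e A B i' [ffun w => braid_defect t A B k l f w].
    apply/ffunP => w; rewrite [LHS]ffunE [X in _ + X]ffunE.
    have [wi|wi] := eqVneq (residues w) i'; first by rewrite !op_eK // [RHS]ffunE.
    by rewrite !op_e_supp // subr0.
  apply/ffunP => w; rewrite /psi_braid.
  have [wi|wi] := eqVneq (residues w) i'.
    rewrite op_eK // ffunE op_psi_braid // wi /= i1 i2 i3.
    rewrite [i (pos k) == _]eq_sym;
      case: (eqVneq (i (pos_next l)) (i (pos k))) => [ii|_] /=; last first.
      by rewrite act0 ffunE.
    rewrite ii; case: ifP => _; first by rewrite act_gen_e Oi op_eK ?ii' // wi ii'.
    case: ifP => _; last by rewrite act0 ffunE.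
    by rewrite actN act_gen_e Oi ffunE op_eK // wi ii'.
  rewrite op_e_supp //; case: ifP => [/andP[/eqP ii _]|_].
    by rewrite act_gen_e Oi op_e_supp // -ii'.
  case: ifP => [/andP[/eqP ii _]|_]; last by rewrite act0 ffunE.
  by rewrite actN act_gen_e Oi ffunE op_e_supp ?oppr0 // -ii'.
Qed.
End Action.

(** * The lattice of polynomial functions *)

Section Lattice.
Variables (R : fieldType).
Local Notation K := {fraction {poly R}}.
Local Notation phi := (@tofrac {poly R} \o polyC).
Local Notation t := (tofrac ('X : {poly R})).

Definition integral (c : K) := exists p : {poly R}, c = tofrac p.

Lemma integralD c d : integral c -> integral d -> integral (c + d).
Proof. by move=> [p ->] [q ->]; exists (p + q); rewrite tofracD. Qed.
Lemma integralM c d : integral c -> integral d -> integral (c * d).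
Proof. by move=> [p ->] [q ->]; exists (p * q); rewrite tofracM. Qed.
Lemma integralN c : integral c -> integral (- c).
Proof. by move=> [p ->]; exists (- p); rewrite tofracN. Qed.
Lemma integral0 : integral 0.
Proof. by exists 0; rewrite tofrac0. Qed.
Lemma integral1 : integral 1.
Proof. by exists 1; rewrite tofrac1. Qed.
Lemma integral_t : integral t.
Proof. by exists 'X. Qed.
Lemma integral_phi c : integral (phi c).
Proof. by exists c%:P. Qed.

Lemma t_neq0 : t != 0.
Proof. by rewrite tofrac_eq0 polyX_eq0. Qed.

Lemma t_not_unit c : integral c -> t * c != 1.
Proof.
move=> [p ->]; apply/eqP; rewrite -tofracM -tofrac1 => /eqP.
rewrite tofrac_eq => /eqP /(congr1 (fun q : {poly R} => q.[0])) /eqP.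
by rewrite hornerM hornerX mul0r hornerC eq_sym oner_eq0.
Qed.

Variables (e n : nat) (A B : residue e).
Hypothesis res_small : forall z : int, res e z = 0 -> z = 0 \/ (3 < `|z|)%N.
Local Notation start := (fun b : bool => if b then B else A).
Local Notation word := (bool ^ n)%type.
Local Notation residues := (@word_residues e n bool start).
Local Notation V := {ffun word -> K}.

(** Polynomial functions with coefficients in R[t]; they are generated inductively so
    that divided differences can be found by recursion. *)
Inductive polyfun : (K ^ n -> K) -> Prop :=
  | PolyConst c of integral c : polyfun (fun=> c)
  | PolyVar i : polyfun (fun x => x i)
  | PolyAdd p q of polyfun p & polyfun q : polyfun (fun x => p x + q x)
  | PolyMul p q of polyfun p & polyfun q : polyfun (fun x => p x * q x).

Lemma polyfun_swap k p : polyfun p -> polyfun (fun x => p (place_swap k x)).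
Proof.
elim=> [c c_int|i|{}p q _ IHp _ IHq|{}p q _ IHp _ IHq].
- exact: PolyConst.
- have -> : (fun x : K ^ n => place_swap k x i) = (fun x => x (swap_perm k i)).
    by apply/funext => x; rewrite place_swapE.
  exact: PolyVar.
- exact: PolyAdd.
- exact: PolyMul.
Qed.

(** The twisted Leibniz rule reduces a product to its factors. *)
Lemma polyfun_divided_difference k p : polyfun p -> exists2 d, polyfun d &
  forall x, p x - p (place_swap k x) = (x (pos_next k) - x (pos k)) * d x.
Proof.
elim=> [c c_int|i|{}p q pp [dp ddp dpE] pq [dq ddq dqE]|{}p q pp [dp ddp dpE] pq [dq ddq
  dqE]].
- by exists (fun=> 0); [apply: PolyConst integral0 | move=> x; rewrite subrr mulr0].
- have [->|ik] := eqVneq i (pos k).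
    exists (fun=> - 1); first by apply/PolyConst/integralN/integral1.
    by move=> x; rewrite place_swapL mulrN1 opprB.
  have [->|ik'] := eqVneq i (pos_next k).
    exists (fun=> 1); first exact/PolyConst/integral1.
    by move=> x; rewrite place_swapR mulr1.
  exists (fun=> 0); first exact/PolyConst/integral0.
  by move=> x; rewrite place_swapD // subrr mulr0.
- exists (fun x => dp x + dq x); first exact: PolyAdd.
  by move=> x; rewrite opprD addrACA dpE dqE mulrDr.
- exists (fun x => dp x * q x + p (place_swap k x) * dq x).
    by apply: PolyAdd; apply: PolyMul => //; apply: polyfun_swap.
  by move=> x; rewrite mulrDr mulrA -dpE mulrCA -dqE; ring.
Qed.

Definition xvals (w : word) : K ^ n := [ffun s => xval t (w s)].

Lemma xvals_swap k w : xvals (place_swap k w) = place_swap k (xvals w).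
Proof. by apply/ffunP => s; rewrite ffunE !place_swapE ffunE. Qed.

Lemma polyfun_integral p w : polyfun p -> integral (p (xvals w)).
Proof.
elim=> [c c_int|i|{}p q _ ? _ ?|{}p q _ ? _ ?] //.
- by rewrite ffunE /xval; case: ifP => _; [apply: integral_t | apply: integral0].
- exact: integralD.
- exact: integralM.
Qed.

(** All coordinates of the points attached to words are 0 or t, hence congruent
    modulo t. *)
Lemma polyfun_congr p w w' : polyfun p ->
  exists2 c, integral c & p (xvals w) - p (xvals w') = t * c.
Proof.
elim=> [c c_int|i|{}p q _ [c ci cE] _ [d di dE]|{}p q pp [c ci cE] pq [d di dE]] //.
- by exists 0; [apply: integral0 | rewrite subrr mulr0].
- rewrite !ffunE /xval; case: (w i); case: (w' i); rewrite ?subrr ?subr0 ?sub0r.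
  + by exists 0; [apply: integral0 | rewrite mulr0].
  + by exists 1; [apply: integral1 | rewrite mulr1].
  + by exists (- 1); [apply/integralN/integral1 | rewrite mulrN1].
  + by exists 0; [apply: integral0 | rewrite mulr0].
- by exists (c + d); [apply: integralD | rewrite opprD addrACA cE dE mulrDr].
- exists (c * q (xvals w) + p (xvals w') * d).
    by apply: integralD; apply: integralM => //; apply: polyfun_integral.
  by rewrite mulrDr mulrA -cE mulrCA -dE; ring.
Qed.

Variable O : perm_orbit n (residue e).
Local Notation free := (free_alg R O).
Local Notation act := (@act R K phi t e n A B O).
Local Notation scale_fun := (@scale_fun K n).

(** On each residue class a function of the lattice is one polynomial in the values of
    the y's; different classes are unrelated. *)
Definition lattice (f : V) :=
  (forall i, exists2 p, polyfun p & forall w, residues w = i -> f w = p (xvals w)) /\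
  (forall w, residues w \notin orbit_set O -> f w = 0).

Lemma latticeD f h : lattice f -> lattice h -> lattice (f + h).
Proof.
move=> [pf sf] [ph sh]; split=> [i|w Ow]; last by rewrite ffunE sf // sh // addr0.
have [p pp fp] := pf i; have [q pq hq] := ph i.
exists (fun x => p x + q x); first exact: PolyAdd.
by move=> w wi; rewrite ffunE fp // hq.
Qed.

Lemma lattice_scale c f : integral c -> lattice f -> lattice (scale_fun c f).
Proof.
move=> ci [pf sf]; split=> [i|w Ow]; last by rewrite ffunE sf // mulr0.
have [p pp fp] := pf i; exists (fun x => c * p x).
  by apply: PolyMul => //; apply: PolyConst.
by move=> w wi; rewrite ffunE fp.
Qed.

Lemma lattice0 : lattice 0.
Proof.
split=> [i|w _]; last by rewrite ffunE.
by exists (fun=> 0); [apply: PolyConst integral0 | move=> w _; rewrite ffunE].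
Qed.

(** Division by the difference of two y's is what the polynomial condition is made
    for: on a class with equal residues at k and k+1, psi_k is a divided difference. *)
Lemma lattice_gen_op (g : generator O) f : lattice f -> lattice (gen_op t A B g f).
Proof.
move=> [pf sf]; split=> [i|w Ow]; last first.
  case: g => [k|s|u] /=; last 2 first.
  - by rewrite ffunE sf // mulr0.
  - by rewrite ffunE sf // if_same.
  have [wk|wk] := eqVneq (w (pos k)) (w (pos_next k)); first by rewrite op_psi_same.
  have Ow' : residues (place_swap k w) \notin orbit_set O.
    rewrite word_residues_swap //; apply: contra Ow => Ow.
    by rewrite -(place_swapK k (residues w)) mem_place_swap.
  by rewrite op_psi_neq // !sf // subrr !mulr0 !if_same.
case: g => [k|s|u] /=.
- have [q qp fq] := pf (place_swap k i).
  have qs := polyfun_swap k qp.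
  have [ab|ab] := eqVneq (i (pos k)) (i (pos_next k)).
    have [d dp dE] := polyfun_divided_difference k qp.
    exists d => // w wi.
    have wk : w (pos k) != w (pos_next k).
      by apply/negP => /eqP /(residue_next A B)/eqP; rewrite wi -ab (sub1_neq res_small).
    have si : place_swap k i = i by rewrite place_swap_id.
    rewrite op_psi_neq // wi ab eqxx !fq ?word_residues_swap ?wi //.
    have := dE (xvals w); rewrite xvals_swap => ->.
    rewrite [xvals w _]ffunE [xvals w _]ffunE mulKf // xvalB //; first exact: t_neq0.
    by rewrite eq_sym.
  have sw w : residues w = i -> w (pos k) != w (pos_next k) ->
      f (place_swap k w) = q (place_swap k (xvals w)).
    by move=> wi wk; rewrite -xvals_swap fq // word_residues_swap // wi.
  have [ba|ba] := boolP (arrow (i (pos_next k)) (i (pos k))).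
    exists (fun x : K ^ n => (x (pos k) + (- 1) * x (pos_next k)) * q (place_swap k x)).
      apply: PolyMul => //; apply: PolyAdd; first exact: PolyVar.
      apply: PolyMul; last exact: PolyVar.
      exact/PolyConst/integralN/integral1.
    move=> w wi; rewrite [xvals w _]ffunE [xvals w _]ffunE mulN1r.
    have [wk|wk] := eqVneq (w (pos k)) (w (pos_next k)).
      by rewrite op_psi_same // wk subrr mul0r.
    by rewrite op_psi_neq // wi (negPf ab) ba sw.
  exists (fun x : K ^ n => q (place_swap k x)) => // w wi.
  have wk : w (pos k) != w (pos_next k).
    by apply/negP => /eqP /(residue_next A B); rewrite wi => ib; rewrite ib arrow_sub in ba.
  by rewrite op_psi_neq // wi (negPf ab) (negPf ba) sw.
- have [p pp fp] := pf i; exists (fun x : K ^ n => x s * p x).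
    by apply: PolyMul => //; apply: PolyVar.
  by move=> w wi; rewrite ffunE fp // ffunE.
- have [iu|iu] := eqVneq i (val u).
    have [p pp fp] := pf i; exists p => // w wi.
    by rewrite ffunE wi iu eqxx -fp // wi.
  exists (fun=> 0); first exact/PolyConst/integral0.
  by move=> w wi; rewrite ffunE wi (negPf iu).
Qed.

Lemma lattice_act a f : lattice f -> lattice (act a f).
Proof.
move=> lf; rewrite actE.
elim: (X in \sum_(m <- X) _) => [|m s IHs]; first by rewrite big_nil; apply: lattice0.
rewrite big_cons; apply: latticeD => //; apply: lattice_scale; first exact: integral_phi.
by elim: (m : seq _) => [|g m' IHm] //=; apply: lattice_gen_op.
Qed.

(** The elements that act by zero on the reduction of the lattice modulo t. *)
Definition vanishes_mod_t (a : free) :=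
  forall f, lattice f -> exists2 h, lattice h & act a f = scale_fun t h.

Lemma scale_fun_0 c : scale_fun c 0 = 0.
Proof. by apply/ffunP => w; rewrite !ffunE mulr0. Qed.

Lemma vanishes_mod_t_of_zero a : act a =1 (fun=> 0) -> vanishes_mod_t a.
Proof.
move=> a0 f _; exists 0; first exact: lattice0.
by rewrite a0 scale_fun_0.
Qed.

Lemma act_scale a c f : act a (scale_fun c f) = scale_fun c (act a f).
Proof.
have opmS (m : seq (generator O)) : word_op t A B m (scale_fun c f) = scale_fun c (word_op
  t A B m f).
  by elim: m => //= g m ->; rewrite gen_op_scale.
rewrite !actE scale_fun_sum; apply: eq_bigr => m _; rewrite opmS.
by apply/ffunP => w; rewrite !ffunE mulrCA.
Qed.

Lemma vanishes_mod_t_ideal : two_sided_ideal vanishes_mod_t.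
Proof.
split=> [|x y kx ky f lf|a x kx f lf|a x kx f lf].
- by apply: vanishes_mod_t_of_zero => f; rewrite act0.
- have [h lh hE] := kx f lf; have [h' lh' hE'] := ky f lf.
  exists (h + h'); first exact: latticeD.
  by rewrite actD hE hE'; apply/ffunP => w; rewrite !ffunE mulrDr.
- have [h lh hE] := kx f lf; exists (act a h); first exact: lattice_act.
  by rewrite actM hE act_scale.
- have [h lh hE] := kx _ (lattice_act a lf); exists h => //.
  by rewrite actM.
Qed.

Lemma residue_first (w : word) (k : 'I_n) : k = 0%N :> nat -> residues w k = start (w k).
Proof.
by move=> k0; rewrite ffunE; have := occ_before_le w k; rewrite k0 leqn0 => /eqP->;
  rewrite res0 subr0.
Qed.

Lemma act_yX m k f w : act (gen R (Y O k) ^+ m) f w = xval t (w k) ^+ m * f w.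
Proof.
elim: m f => [|m IHm] f; first by rewrite !expr0 act1 mul1r.
by rewrite exprS actM act_gen /= ffunE IHm exprS mulrA.
Qed.

Lemma lattice_e i f : i \in orbit_set O -> lattice f -> lattice (op_e A B i f).
Proof. by move=> Oi; apply: (@lattice_gen_op (E (FSetSub Oi))). Qed.

Lemma vanishes_mod_t_gen_e i : (forall w, residues w != i) -> vanishes_mod_t (gen_e R O i).
Proof.
move=> no_w; apply: vanishes_mod_t_of_zero => f; rewrite act_gen_e; case: ifP => // _.
by apply/ffunP => w; rewrite op_e_supp // ffunE.
Qed.

Definition all_A : word := [ffun=> false].

(** Swapping letters never leads into the word A...A from another word. *)
Lemma act_all_A (a : free) (f : V) : f all_A = 0 -> act a f all_A = 0.
Proof.
move=> f0; rewrite actE sum_ffunE big1 // => m _; rewrite ffunE.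
suff -> : word_op t A B m f all_A = 0 by rewrite mulr0.
elim: (m : seq _) => [//|g m' IHm] /=.
case: g => [k|s|u] /=; first by rewrite op_psi_same // !ffunE.
  by rewrite ffunE IHm mulr0.
by rewrite ffunE IHm if_same.
Qed.

Section Relators.
Variable L : weight e.
Hypothesis AB : A != B.
Hypothesis LA : (0 < L A)%N.
Hypothesis LB : (0 < L B)%N.

(** For the cyclotomic relation the first residue decides the first letter, as A and B
    differ, so y_1 acts on the class of i by the constant t or 0. *)
Lemma vanishes_mod_t_relator a : relator L (O := O) a -> vanishes_mod_t a.
Proof.
move=> [lhs [rhs [rel ->]]].
case: (act_rel phi A B t_neq0 res_small rel) => [eq_act|[i [k [Oi k0 [-> ->]]]]|[-> ->]].
- by apply: vanishes_mod_t_of_zero => f; rewrite actB eq_act subrr.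
- move=> f lf; rewrite subr0.
  suff [h lh hE] : exists2 h, lattice h &
      act (gen R (Y O k) ^+ L (i k)) (op_e A B i f) = scale_fun t h.
    by exists h => //; rewrite [LHS]actM act_gen_e Oi.
  have le := lattice_e Oi lf.
  have letter0 w : residues w = i -> w k = (i k == B).
    by move=> <-; rewrite residue_first //; case: (w k); rewrite ?eqxx // (negPf AB).
  have [iB|iB] := eqVneq (i k) B.
    exists (scale_fun (t ^+ (L B).-1) (op_e A B i f)).
      apply: lattice_scale => //.
      by exists ('X ^+ (L B).-1); rewrite tofracXn.
    apply/ffunP => w; rewrite act_yX [RHS]ffunE [scale_fun _ _ w]ffunE mulrA -exprS (prednK
      LB).
    have [wi|wi] := eqVneq (residues w) i; last by rewrite (op_e_supp _ wi) !mulr0.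
    by rewrite (letter0 w wi) iB eqxx.
  exists 0; first exact: lattice0.
  apply/ffunP => w; rewrite act_yX scale_fun_0 [RHS]ffunE.
  have [wi|wi] := eqVneq (residues w) i; last by rewrite (op_e_supp _ wi) mulr0.
  have : (0 < L (i k))%N by rewrite -wi residue_first //; case: (w k).
  by rewrite (letter0 w wi) (negPf iB) /xval expr0n => /lt0n_neq0/negPf->; rewrite mul0r.
- move=> f [pf sf]; exists 0; first exact: lattice0.
  rewrite scale_fun_0.
  rewrite actB act1 act_sum; apply/eqP; rewrite subr_eq0; apply/eqP/ffunP => w.
  rewrite sum_ffunE big_seq (eq_bigr (fun i => if residues w == i then f w else 0));
    last first.
    by move=> i Oi; rewrite act_gen_e Oi ffunE.
  rewrite -big_seq -big_mkcond /=.
  have [Ow|Ow] := boolP (residues w \in orbit_set O); last first.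
    rewrite sf // big1_seq // => i /andP[/eqP <-]; by rewrite (negPf Ow).
  rewrite -big_filter (_ : [seq i <- orbit_set O |
    residues w == i] = [:: residues w]) ?big_seq1 //.
  rewrite (eq_filter (a2 := pred1 (residues w))); last by move=> i /=; rewrite eq_sym.
  by rewrite filter_pred1_uniq ?fset_uniq.
Qed.
End Relators.

Variables (d : nat) (dn : (d < n)%N).
Hypothesis def_B : B = A - res e d%:Z.

Definition A_then_B : word := [ffun s : 'I_n => (d <= s)%N].

Lemma occ_before_interval (w : word) (s : 'I_n) (a b : nat) : (b <= s)%N ->
  (forall x : 'I_n, (x < s)%N -> (w x == w s) = (a <= x < b)%N) ->
  occ_before w s = (b - a)%N.
Proof.
move=> bs wE; rewrite /occ_before.
rewrite -[RHS](size_iota a) cardE -(size_map val); apply/perm_size/uniq_perm.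
- by rewrite map_inj_uniq ?enum_uniq //; apply: val_inj.
- exact: iota_uniq.
move=> x; rewrite mem_iota; apply/mapP/idP => [[y + ->]|xab].
  rewrite mem_enum inE => /andP[ys]; rewrite wE // => /andP[ay yb] /=.
  by rewrite ay subnKC // (leq_trans ay (ltnW yb)).
have xn : (x < n)%N by apply: leq_ltn_trans (ltn_ord s); lia.
by exists (Ordinal xn) => //; rewrite mem_enum inE wE /=; lia.
Qed.

Lemma occ_before_all_A s : occ_before all_A s = s.
Proof.
rewrite (@occ_before_interval _ _ 0 s) ?subn0 // => x xs.
by rewrite !ffunE eqxx xs.
Qed.

(** The column that starts at B = A - d continues the residues of d boxes below A. *)
Lemma residues_A_then_B : residues A_then_B = residues all_A.
Proof.
apply/ffunP => s; rewrite [RHS]ffunE occ_before_all_A !ffunE /=.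
case: (leqP d s) => ds.
  rewrite (@occ_before_interval _ _ d s) // => [|x xs]; last first.
    by rewrite !ffunE ds xs andbT; case: leqP.
  by rewrite def_B -subzn // resB opprB addrA subrK.
rewrite (@occ_before_interval _ _ 0 s) ?subn0 // => x xs.
rewrite !ffunE (leqNgt d s) ds xs /=.
by rewrite leqNgt (ltn_trans xs ds).
Qed.

Lemma act_regular (x z : free) f :
  act (x * z * x - x) f = act x (act z (act x f)) - act x f.
Proof. by rewrite actB; congr (_ - _); rewrite 2![LHS]actM. Qed.

(** Let f0 = 1 on the class of i.  The function g = z x f0 vanishes at A...A, hence is
    divisible by t at A...AB...B.  So x z x f0 - x f0 is t times a function with the
    values 0 and g - 1 at these two words, which are not congruent modulo t. *)
Lemma not_regular (i := residues all_A) (x := gen R (Y O (Ordinal dn)) * gen_e R O i) z :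
  i \in orbit_set O -> ~ vanishes_mod_t (x * z * x - x).
Proof.
move=> Oi killed.
have actx f : act x f = op_y t (Ordinal dn) (op_e A B i f).
  by rewrite actM act_gen_e Oi act_gen.
pose f0 : V := op_e A B i [ffun=> 1].
have lf0 : lattice f0.
  split=> [i'|w Ow]; last by rewrite op_e_supp //; apply: contraNneq Ow => ->.
  have [->|ii'] := eqVneq i' i.
    exists (fun=> 1); first exact/PolyConst/integral1.
    by move=> w wi; rewrite op_eK // ffunE.
  exists (fun=> 0); first exact/PolyConst/integral0.
  by move=> w wi; rewrite op_e_supp // wi.
have iT : residues A_then_B = i by exact: residues_A_then_B.
have lu : lattice (act x f0) by apply: lattice_act.
have lg : lattice (act z (act x f0)) by apply: lattice_act.
have g0 : act z (act x f0) all_A = 0.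
  by apply: act_all_A; rewrite actx ffunE /xval ffunE mul0r.
have [h lh] := killed f0 lf0; rewrite act_regular.
move: (act z _) lg g0 => g lg g0; rewrite !actx => hE.
have h0 : h all_A = 0.
  have := congr1 (fun f : V => f all_A) hE; rewrite /=.
  move=> /eqP; rewrite ffunE [X in _ + X]ffunE [scale_fun _ _ _]ffunE.
  rewrite ![op_y _ _ _ all_A]ffunE /xval ffunE !mul0r subrr eq_sym mulf_eq0.
  by rewrite (negPf t_neq0) /= => /eqP.
have hT : h A_then_B = g A_then_B - 1.
  have := congr1 (fun f : V => f A_then_B) hE; rewrite /=.
  rewrite ffunE [X in _ + X]ffunE [scale_fun _ _ _]ffunE ![op_y _ _ _ A_then_B]ffunE.
  rewrite /xval ffunE /= leqnn !op_eK // [[ffun=> 1] _]ffunE.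
  by rewrite -mulrBr => /(mulfI t_neq0).
have [p pp hp] := lh.1 i; have [q pq gq] := lg.1 i.
have [c ci cE] := polyfun_congr A_then_B all_A pp.
have [c' ci' cE'] := polyfun_congr A_then_B all_A pq.
move: cE cE'; rewrite -!hp // -!gq // h0 g0 !subr0 hT => cE cE'.
have /eqP[] := t_not_unit (integralD ci' (integralN ci)).
by rewrite mulrDr mulrN -cE -cE' opprB addrC subrK.
Qed.
End Lattice.

(** * Components that are too close *)

Section NotSemisimple.
Variables (R : fieldType) (e n : nat) (L : weight e) (A B : residue e) (d : nat).
Hypothesis res_small : forall z : int, res e z = 0 -> z = 0 \/ (3 < `|z|)%N.
Hypothesis LA : (0 < L A)%N.
Hypothesis LB : (0 < L B)%N.
Hypothesis dn : (d < n)%N.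
Hypothesis def_B : B = A - res e d%:Z.
Hypothesis AB_far : forall z : int, A = B + res e z -> (1 < `|z|)%N.
Hypothesis L_below : forall b m, (0 < m <= 2)%N ->
  L ((if b then B else A) - res e m%:Z) = 0%N.

Local Notation start := (fun b : bool => if b then B else A).
Local Notation residues := (@word_residues e n bool start).

Let AB : A != B.
Proof. by apply/eqP => AB; have := @AB_far 0; rewrite res0 addr0 => /(_ AB). Qed.

Lemma quot_projP (Q : pzRingType) (S : Q -> Prop) (x y : Q) :
  quot_proj S x = quot_proj S y -> generated_ideal S (x - y).
Proof. by move=> xy; apply/quot_eqP/eqP. Qed.

Lemma quot_proj_surj (Q : pzRingType) (S : Q -> Prop) (z : quot_ring S) :
  exists x, z = quot_proj S x.
Proof. by exists (repr z); rewrite /quot_proj reprK. Qed.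

Lemma occ_before_gt0 (w : bool ^ n) (s p : 'I_n) : (s < p)%N -> w s = w p ->
  (0 < occ_before w p)%N.
Proof. by move=> sp ws; apply/card_gt0P; exists s; rewrite inE sp ws eqxx. Qed.

(** No word starts with residues c, c + 1, and among the first three letters two
    agree, so that one of the first three residues lies one or two below a start
    and is not a summand of the weight. *)
Lemma vanishes_mod_t_TL_generator (O : perm_orbit n (residue e)) (f : KLR R n L) :
  TL_generator f -> exists2 a, vanishes_mod_t A B a & quot_proj (relator L (O := O)) a = f
    O.
Proof.
case=> [i k1 k2 k10 k21 Li1 i2|i k1 k2 k3 k10 k21 k32 _ [Li1 Li2 Li3]];
  exists (gen_e R O i) => //; apply: vanishes_mod_t_gen_e => w; apply/eqP => wi; move: Li1;
    rewrite -wi.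
  move: i2; rewrite -wi !(residue_first _ _ _ k10) => i2 _; move: i2.
  have k12 : (k1 < k2)%N by rewrite k10 k21.
  rewrite ffunE; have [wk|wk] := eqVneq (w k1) (w k2).
    have -> : occ_before w k2 = 1%N.
      by apply/eqP; rewrite eqn_leq (occ_before_gt0 k12 wk) andbT -[X in (_ <= X)%N]k21
        occ_before_le.
    rewrite wk => /eqP; rewrite -subr_eq -addrA -subr_eq0 [X in X - _]addrC addrK -opprD
      oppr_eq0.
    by rewrite (negPf (res2_neq0 res_small)).
  have -> : occ_before w k2 = 0%N.
    apply/eqP; rewrite -leqn0 leqNgt; apply/negP => /card_gt0P[s].
    rewrite inE k21 => /andP[s0 /eqP ws]; have sk : s = k1 by apply: val_inj;
      rewrite /= k10; lia.
    by rewrite -ws sk eqxx in wk.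
  rewrite res0 subr0; case: (w k1) (w k2) wk => [] [] // _ => [AE|BE].
    by have := AB_far AE.
  have := @AB_far (-1); rewrite resN BE addrK => /(_ erefl).
  by [].
move: Li2 Li3; rewrite -wi => Li2 Li3 _.
have below (p : 'I_n) : (0 < occ_before w p)%N -> (p <= 2)%N -> L (residues w p) = 0%N.
  move=> c0 p2; rewrite ffunE; apply: L_below.
  by rewrite c0 (leq_trans (occ_before_le w p) p2).
have k12 : (k1 < k2)%N by rewrite k10 k21.
have k13 : (k1 < k3)%N by rewrite k10 k32.
have k23 : (k2 < k3)%N by rewrite k21 k32.
have [w12|w12] := eqVneq (w k1) (w k2).
  by rewrite below ?(occ_before_gt0 k12) // k21 in Li2.
have [w13|w13] := eqVneq (w k1) (w k3).
  by rewrite below ?(occ_before_gt0 k13) // k32 in Li3.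
have w23 : w k2 = w k3 by move: w12 w13; case: (w k1) (w k2) (w k3) => [] [] [].
by rewrite below ?(occ_before_gt0 k23) // k32 in Li3.
Qed.

(** The elements of the direct sum over all orbits are tested on the orbit of i only:
    those whose component there has a representative that acts by zero modulo t
    form a two-sided ideal. *)
Theorem TL_not_semisimple : ~ semisimple (TL R n L).
Proof.
move=> /semisimple_regular reg.
pose i := residues (all_A n).
have exO : exists i0, place_orbit i = place_orbit i0 by exists i.
pose O := PermOrbit exO.
have Oi : i \in orbit_set O.
  apply/place_orbitP; exists 1%g; apply/ffunP => k.
  by rewrite [RHS]ffunE fingroup.invg1 perm1.
pose x O' := gen R (Y O' (Ordinal dn)) * gen_e R O' i.
pose X : KLR R n L := fun O' => quot_proj (relator L (O := O')) (x O').
have [z xzx] := reg (quot_proj (@TL_generator R e n L) X).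
have [Z zZ] := quot_proj_surj z; rewrite zZ in xzx.
have XZX : generated_ideal (@TL_generator R e n L) (X * Z * X - X).
  by apply: quot_projP; rewrite !rmorphM.
have [c Zc] := quot_proj_surj (Z O).
pose J (f : KLR R n L) := exists2 a, vanishes_mod_t A B a & quot_proj (relator L (O := O))
  a = f O.
have kI : two_sided_ideal (@vanishes_mod_t R e n A B O) by apply: vanishes_mod_t_ideal.
have iJ : two_sided_ideal J.
  split=> [|f g [a ka aE] [b kb bE]|g f [a ka aE]|g f [a ka aE]].
  - by exists 0; [apply: ideal_0 kI | rewrite rmorph0].
  - by exists (a + b); [apply: (ideal_D kI) | rewrite rmorphD /= aE bE].
  - have [b bE] := quot_proj_surj (g O).
    by exists (b * a); [apply: (ideal_Ml kI) | rewrite rmorphM /= aE -bE].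
  - have [b bE] := quot_proj_surj (g O).
    by exists (a * b); [apply: (ideal_Mr kI) | rewrite rmorphM /= aE -bE].
have [a ka aE] : J (X * Z * X - X).
  by apply: XZX => // f; apply: vanishes_mod_t_TL_generator.
apply: (not_regular res_small (dn := dn) (z := c) def_B Oi).
have aE' : quot_proj (relator L (O := O)) (x O * c * x O - x O) = quot_proj _ a.
  rewrite aE; move: (x O) (erefl : X O = quot_proj _ (x O)) => b XO.
  by rewrite rmorphB !rmorphM /= -Zc -XO.
have /quot_projP gen_a := aE'.
rewrite -[X in vanishes_mod_t _ _ X](subrK a); apply: (ideal_D kI) => //.
apply: gen_a => // b; exact: (vanishes_mod_t_relator res_small AB LA LB).
Qed.
End NotSemisimple.

(** * Idempotents and words for separated components *)

(** The bounds below follow from order facts; disequalities would be case-split. *)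
Ltac small_lia := repeat match goal with
  | H : forall _, _ |- _ => clear H
  | H : is_true (~~ _) |- _ => clear H
  end; lia.

Section Separated.
Variables (e n r : nat) (j : 'I_r -> residue e).
Local Notation I := (residue e).
Variable Q : pzRingType.
Variables (E : I ^ n -> Q) (psi : 'I_n.-1 -> Q) (y : 'I_n -> Q).
Local Notation "1r" := (res e 1).
Implicit Types (i : I ^ n) (k l : 'I_n.-1) (p q s : 'I_n) (a b c : 'I_r) (w : 'I_r ^ n).

Hypothesis start_far : forall a b (z : int),
  j a = j b + res e z -> (`|z| < n)%N -> a = b /\ z = 0.
Hypothesis res2 : 1r + 1r != 0.

(** Residues for which psi_k^2 is not the identity. *)
Definition linked (u v : I) := [|| u == v, arrow u v | arrow v u].

Hypothesis E_first : forall i p, p = 0%N :> nat -> E i != 0 ->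
  exists2 a, i p = j a & y p * E i = 0.
Hypothesis E_y : forall i p, E i * y p = y p * E i.
Hypothesis psi_E : forall i k, psi k * E i = E (place_swap k i) * psi k.
Hypothesis psi_y_next : forall i k, psi k * y (pos_next k) * E i =
  (y (pos k) * psi k + (i (pos k) == i (pos_next k))%:R) * E i.
Hypothesis y_next_psi : forall i k, y (pos_next k) * psi k * E i =
  (psi k * y (pos k) + (i (pos k) == i (pos_next k))%:R) * E i.
Hypothesis psi_sq : forall i k, psi k ^+ 2 * E i =
  if i (pos k) == i (pos_next k) then 0
  else if arrow (i (pos k)) (i (pos_next k)) then (y (pos_next k) - y (pos k)) * E i
  else if arrow (i (pos_next k)) (i (pos k)) then (y (pos k) - y (pos_next k)) * E i
  else E i.
Hypothesis psi_braid : forall i k l, l = k.+1 :> nat ->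
  i (pos_next l) = i (pos k) -> arrow (i (pos k)) (i (pos l)) || arrow (i (pos l)) (i (pos
    k)) ->
  psi k * E i = 0 -> psi l * E i = 0 -> E i = 0.
Hypothesis E_two : forall i p q, p = 0%N :> nat -> q = 1%N :> nat ->
  forall a, i p = j a -> i q = i p + 1r -> E i = 0.
Hypothesis E_three : forall i p q s, p = 0%N :> nat -> q = 1%N :> nat -> s = 2%N :> nat ->
  forall a b c, uniq [:: a; b; c] -> i p = j a -> i q = j b -> i s = j c -> E i = 0.

Local Notation residues := (word_residues j).

(** A residue determines its column and its depth as long as depths stay below n. *)
Lemma label_inj a b (x z : int) : j a - res e x = j b - res e z -> (`|x - z| < n)%N ->
  a = b /\ x = z.
Proof.
move=> /eqP; rewrite subr_eq -addrA => /eqP jab xz.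
have [|-> xz0] := @start_far a b (x - z) _ xz.
  by rewrite jab resD resN [- _ + _]addrC.
by split=> //; apply/eqP; rewrite -subr_eq0 xz0.
Qed.

Lemma letter_of_residue w p a (x : int) : residues w p = j a - res e x -> (`|x| < n)%N ->
  (0 <= x) -> w p = a /\ (occ_before w p)%:Z = x.
Proof.
rewrite ffunE => eq_w xn x0; apply: label_inj eq_w _.
have := occ_before_le w p; have := ltn_ord p; small_lia.
Qed.

Lemma letter_inj w w' p : residues w p = residues w' p -> w p = w' p /\
  occ_before w p = occ_before w' p.
Proof.
rewrite [in RHS]ffunE => /letter_of_residue; have := occ_before_le w' p; have := ltn_ord p.
move=> pn wp [||-> [->]] //=; small_lia.
Qed.

Lemma residue_letter w p : residues w p = j (w p) - res e (occ_before w p)%:Z.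
Proof. by rewrite ffunE. Qed.

Lemma linkedN a b (x z : int) : a != b -> (`|x - z|.+1 < n)%N ->
  ~~ linked (j a - res e x) (j b - res e z).
Proof.
move=> ab xz; apply/negP => /or3P[/eqP||].
- by move=> /label_inj[|]; [small_lia | move=> abE; rewrite abE eqxx in ab].
- move=> /eqP jb; have : j b - res e z = j a - res e (x - 1).
    by rewrite jb resB opprB addrA addrAC.
  by move=> /label_inj[|]; [small_lia | move=> abE; rewrite abE eqxx in ab].
- move=> /eqP jb; have : j a - res e x = j b - res e (z - 1).
    by rewrite jb resB opprB addrA addrAC.
  by move=> /label_inj[|]; [small_lia | move=> abE; rewrite abE eqxx in ab].
Qed.

Lemma psi_sqN i k : ~~ linked (i (pos k)) (i (pos_next k)) -> psi k * psi k * E i = E i.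
Proof.
rewrite /linked !negb_or => /and3P[h1 h2 h3].
by rewrite -expr2 psi_sq (negPf h1) (negPf h2) (negPf h3).
Qed.

Lemma E_swap_neq0 i k : E i != 0 -> ~~ linked (i (pos k)) (i (pos_next k)) ->
  E (place_swap k i) != 0.
Proof.
move=> Ei nl; apply: contra Ei => /eqP Es.
by rewrite -(psi_sqN nl) -mulrA psi_E Es mul0r mulr0.
Qed.

(** That no three letters are distinct says that there are at most two, without naming
    them. *)
Definition prefix_word (m : nat) i := exists w,
  (forall p, (p < m)%N -> residues w p = i p) /\
  (forall p q s, (p < m)%N -> (q < m)%N -> (s < m)%N -> ~~ uniq [:: w p; w q; w s]).

(** The word w' agrees with the swapped word up to position k. *)
Lemma occ_before_skip w w' k : w (pos k) != w (pos_next k) -> w' (pos k) = w (pos_next k) ->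
  (forall s, (s < pos k)%N -> w' s = w s) ->
  occ_before w (pos_next k) = occ_before w' (pos k).
Proof.
move=> wk wk' ww'; have := occ_before_swap (pos k) wk; rewrite tpermL => <-.
apply: eq_occ_before => s; rewrite leq_eqVlt => /predU1P[/val_inj->|sk].
  by rewrite place_swapL wk'.
by rewrite place_swapD ?ww' // -val_eqE /= neq_ltn ?(ltn_trans sk (ltnSn k)) ?sk.
Qed.

Lemma uniq3 a b c : uniq [:: a; b; c] = [&& a != b, a != c & b != c].
Proof. by rewrite /= !inE negb_or andbT andbA. Qed.

Lemma occ_before_eq0 w p : (forall s, (s < p)%N -> w s != w p) -> occ_before w p = 0%N.
Proof.
move=> wp; apply/eqP; rewrite -leqn0 leqNgt; apply/negP => /card_gt0P[s].
by rewrite inE => /andP[/wp/negPf->].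
Qed.

Section Step.
Variables (m : nat) (mn : (m.+1 < n)%N).
Hypothesis IH : forall i, E i != 0 -> prefix_word m.+1 i /\ (forall p, (p < m.+1)%N ->
  y p * E i = 0).

Lemma lt_m_pred : (m < n.-1)%N. Proof. by case: (n) mn. Qed.
Let k : 'I_n.-1 := Ordinal lt_m_pred.
Let n_gt0 : (0 < n)%N := leq_ltn_trans (leq0n _) mn.
Let p0 : 'I_n := Ordinal n_gt0.

(** Let the first m boxes fill one column while the next two boxes open two new
    columns.  For m = 1 the idempotent is one of the generators of the ideal.
      For m > 1 both
    openings can be moved in front of the last box of the first column, and a prefix of
    length m + 1 with three letters appears. *)
Lemma step_three_letters i w a b c : E i != 0 -> (0 < m)%N -> uniq [:: a; b; c] ->
  (forall p, (p < m.+1)%N -> residues w p = i p) ->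
  (forall p, (p < m)%N -> w p = a) -> w (pos k) = b -> i (pos_next k) = j c -> False.
Proof.
move=> Ei m0 abc wi wa wb ic.
move: (abc); rewrite uniq3 => /and3P[ab ac bc].
have ia p : (p < m)%N -> i p = j a - res e p%:Z.
  move=> pm; rewrite -wi; last by rewrite ltnS ltnW.
  rewrite residue_letter wa //; congr (_ - res e _%:Z).
  have -> : occ_before w p = occ_before ([ffun=> a] : 'I_r ^ n) p.
    by apply: eq_occ_before => s sp; rewrite ffunE wa // (leq_ltn_trans sp).
  rewrite /occ_before -[RHS](size_iota 0) cardE -(size_map val); apply/perm_size/uniq_perm.
  - by rewrite map_inj_uniq ?enum_uniq //; apply: val_inj.
  - exact: iota_uniq.
  move=> x; rewrite mem_iota /= add0n; apply/mapP/idP => [[s + ->]|xp].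
    by rewrite mem_enum inE => /andP[].
  exists (Ordinal (ltn_trans xp (ltn_ord p))) => //.
  by rewrite mem_enum inE /= !ffunE eqxx andbT.
have ib : i (pos k) = j b.
  rewrite -wi //= residue_letter occ_before_eq0 ?wb ?res0 ?subr0 // => s sm.
  by rewrite wa.
have [m1|m1] := eqVneq m 1%N.
  have i0 : i p0 = j a.
    by rewrite ia ?m1 // res0 subr0.
  by case/eqP: Ei; apply: (E_three (s := pos_next k) _ _ _ abc i0 ib ic) => //=; rewrite m1.
have m1' : (1 < m)%N by rewrite ltn_neqAle eq_sym m1.
have mp : (m.-1 < n.-1)%N by apply: leq_ltn_trans (leq_pred m) lt_m_pred.
pose k1 : 'I_n.-1 := Ordinal mp.
have pk1 : pos_next k1 = pos k by apply: val_inj; rewrite /= prednK.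
have k1k : pos_next k != pos k1 by rewrite -val_eqE /=; small_lia.
have k1k' : pos_next k != pos_next k1 by rewrite pk1 eq_sym pos_neq.
have k1k'' : pos k1 != pos k by rewrite -pk1 pos_neq.
have nl1 : ~~ linked (i (pos k1)) (i (pos_next k1)).
  rewrite pk1 ib ia /=; last by rewrite prednK.
  by rewrite -[j b]subr0 -(res0 e); apply: linkedN => //; small_lia.
have Ei1 := E_swap_neq0 Ei nl1.
set i1 := place_swap k1 i in Ei1.
have i1k : i1 (pos k) = i (pos k1) by rewrite /i1 -pk1 place_swapR.
have i1k' : i1 (pos_next k) = j c by rewrite /i1 place_swapD.
have nl2 : ~~ linked (i1 (pos k)) (i1 (pos_next k)).
  rewrite i1k i1k' ia /=; last by rewrite prednK.
  by rewrite -[j c]subr0 -(res0 e); apply: linkedN => //; small_lia.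
have [[w2 [wi2 two2]] _] := IH (E_swap_neq0 Ei1 nl2).
have letter q d : (q < m.+1)%N -> place_swap k i1 q = j d -> w2 q = d.
  move=> qm iq; have eq : residues w2 q = j d - res e 0 by rewrite wi2 // iq res0 subr0.
  by have [] := letter_of_residue eq n_gt0 isT.
have p01 : p0 != pos k by rewrite -val_eqE /= neq_ltn m0.
have p02 : p0 != pos_next k by rewrite -val_eqE.
have p03 : p0 != pos k1 by rewrite -val_eqE /= neq_ltn -ltnS prednK ?m1'.
have p04 : p0 != pos_next k1 by rewrite pk1.
have l0 : w2 p0 = a.
  by apply: letter; rewrite ?place_swapD // ia // res0 subr0.
have l1 : w2 (pos k1) = b.
  apply: letter; first by rewrite /=; small_lia.
  by rewrite place_swapD ?k1k'' // 1?eq_sym // /i1 place_swapL pk1.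
have l2 : w2 (pos k) = c by apply: letter => //; rewrite place_swapL.
have : ~~ uniq [:: w2 p0; w2 (pos k1); w2 (pos k)] by apply: two2 => //=; small_lia.
by rewrite l0 l1 l2 abc.
Qed.

Lemma lt_next p : (p < m.+2)%N -> (p < m.+1)%N \/ p = pos_next k.
Proof.
by rewrite [in X in X -> _]ltnS leq_eqVlt => /predU1P[pk|]; [right; apply: val_inj | left].
Qed.

Lemma lt_pos p : (p < m.+1)%N -> (p < m)%N \/ p = pos k.
Proof.
by rewrite ltnS leq_eqVlt => /predU1P[pk|]; [right; apply: val_inj | left].
Qed.

Lemma swap_below (T : choiceType) (x : T ^ n) p : (p < m)%N -> place_swap k x p = x p.
Proof. by move=> pm; apply: place_swapD; rewrite -val_eqE /=; small_lia. Qed.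

Lemma letters_agree i w w' :
  (forall p, (p < m.+1)%N -> residues w p = i p) ->
  (forall p, (p < m.+1)%N -> residues w' p = place_swap k i p) ->
  forall p, (p < m)%N -> w p = w' p.
Proof.
move=> wi wi' p pm; have pm1 : (p < m.+1)%N by rewrite ltnS ltnW.
by have [] := @letter_inj w w' p; rewrite ?wi ?wi' ?swap_below.
Qed.

Definition extend w a : 'I_r ^ n := [ffun p => if p == pos_next k then a else w p].

Lemma extend_below w a p : (p < m.+1)%N -> extend w a p = w p.
Proof. by move=> pm; rewrite ffunE -val_eqE /= ltn_eqF. Qed.

Lemma residue_extend_below w a p : (p < m.+1)%N -> residues (extend w a) p = residues w p.
Proof.
move=> pm; rewrite !residue_letter extend_below //; congr (_ - res e _%:Z).
by apply: eq_occ_before => s sp; rewrite extend_below // (leq_ltn_trans sp).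
Qed.

Lemma extend_next w a : extend w a (pos_next k) = a.
Proof. by rewrite ffunE eqxx. Qed.

Lemma prefix_word_extend i w a :
  (forall p, (p < m.+1)%N -> residues w p = i p) ->
  residues (extend w a) (pos_next k) = i (pos_next k) ->
  (forall p q s, (p < m.+2)%N -> (q < m.+2)%N -> (s < m.+2)%N ->
    ~~ uniq [:: extend w a p; extend w a q; extend w a s]) -> prefix_word m.+2 i.
Proof.
move=> wi wa two; exists (extend w a); split=> // p /lt_next[pm|-> //].
by rewrite residue_extend_below // wi.
Qed.

(** The boxes m and m + 1 can be exchanged, and the induction hypothesis applies to both
    orders; it gives two words that agree below position m. *)
Lemma step_unlinked i : E i != 0 -> ~~ linked (i (pos k)) (i (pos_next k)) ->
  prefix_word m.+2 i /\ (forall p, (p < m.+2)%N -> y p * E i = 0).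
Proof.
move=> Ei nl; have [[w [wi two]] yi] := IH Ei.
have Ei' := E_swap_neq0 Ei nl; have [[w' [wi' two']] yi'] := IH Ei'.
split; last first.
  move=> p /lt_next[/yi //|->].
  rewrite -(psi_sqN nl) -[psi k * psi k * _]mulrA psi_E !mulrA y_next_psi.
  rewrite place_swapL place_swapR eq_sym.
  case: eqP nl => [->|_ _]; first by rewrite /linked eqxx.
  by rewrite addr0 -[psi k * _ * _]mulrA yi' // mulr0 mul0r.
have ww' := letters_agree wi wi'.
have w'k : residues w' (pos k) = i (pos_next k) by rewrite wi' // place_swapL.
have wne : w (pos k) != w' (pos k).
  apply/eqP => wk; move: nl; rewrite -w'k -wi //= !residue_letter wk.
  have -> : occ_before w (pos k) = occ_before w' (pos k).
    by apply: eq_occ_before => s; rewrite -ltnS => /lt_pos[/ww'|->].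
  by rewrite /linked eqxx.
set a := w (pos k) in wne; set b := w' (pos k) in wne.
apply: (prefix_word_extend (w := w) (a := b)) => //.
  rewrite residue_letter extend_next -w'k residue_letter -/b; congr (_ - res e _%:Z).
  apply: occ_before_skip; rewrite ?extend_next ?extend_below //.
  by move=> s /= sm; rewrite extend_below ?ww' // ltnS ltnW.
suff ab_only p : (p < m.+2)%N -> extend w b p \in [:: a; b].
  move=> p q s /ab_only + /ab_only + /ab_only; rewrite uniq3 !inE.
  by do 3![case/orP=> /eqP->]; rewrite ?eqxx ?andbF.
move=> /lt_next[pm|->]; last by rewrite extend_next !inE eqxx orbT.
rewrite extend_below //; have [{}pm|->] := lt_pos pm; last by rewrite inE eqxx.
apply/negP => /negP; rewrite !inE negb_or => /andP[pa pb].
have np q (qm : (q < m)%N) : w q = w p.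
  have lt1 s : (s < m)%N -> (s < m.+1)%N by move=> sm; rewrite ltnS ltnW.
  have := two q p (pos k) (lt1 _ qm) (lt1 _ pm) (ltnSn m).
  have := two' q p (pos k) (lt1 _ qm) (lt1 _ pm) (ltnSn m).
  rewrite -(ww' q qm) -(ww' p pm) -/a -/b !uniq3 pa pb !andbT !negb_and !negbK.
  case/orP=> [/eqP//|/eqP->]; case/orP=> [/eqP//|/eqP abE].
  by rewrite abE eqxx in wne.
apply: (@step_three_letters i w (w p) a b Ei _ _ wi np) => //.
- exact: leq_ltn_trans pm.
- by rewrite uniq3 pa pb wne.
rewrite -w'k residue_letter occ_before_eq0 ?res0 ?subr0 // => s sm.
by rewrite -ww' // np.
Qed.

Lemma psi_E0 i l : E (place_swap l i) = 0 -> psi l * E i = 0.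
Proof. by move=> Es; rewrite psi_E Es mul0r. Qed.

(** From y_k e(i) = 0 and psi_k^2 e(i) = 0 the relations between psi_k and y_(k+1) give
    first psi_k e(i) = 0 and then e(i) = 0. *)
Lemma step_equal i : E i != 0 -> i (pos k) <> i (pos_next k).
Proof.
move=> Ei ik; have [_ yi] := IH Ei; case/eqP: Ei.
have si : place_swap k i = i by exact: place_swap_id.
have E1 : E i = psi k * y (pos_next k) * E i.
  rewrite psi_y_next ik eqxx mulrDl mul1r -mulrA psi_E si mulrA.
  by rewrite yi // mul0r add0r.
have E2 : E i = y (pos_next k) * psi k * E i.
  by rewrite y_next_psi ik eqxx mulrDl mul1r -mulrA yi // mulr0 add0r.
rewrite E2 -mulrA; suff -> : psi k * E i = 0 by rewrite mulr0.
by rewrite {1}E1 -mulrA -E_y !mulrA -expr2 psi_sq ik eqxx mul0r.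
Qed.

(** The column of the last letter grows.  The swapped sequence would put a box at
    depth c + 1 before the box at depth c, so psi_k e(i) = 0, and then psi_k^2 gives
    y_(k+1) e(i) = y_k e(i) = 0. *)
Lemma step_down i : E i != 0 -> i (pos_next k) = i (pos k) - 1r ->
  [/\ prefix_word m.+2 i, (forall p, (p < m.+2)%N -> y p * E i = 0) & psi k * E i = 0].
Proof.
move=> Ei ik; have [[w [wi two]] yi] := IH Ei.
set a := w (pos k); set c := occ_before w (pos k).
have cm : (c <= m)%N by apply: (occ_before_le w (pos k)).
have ikE : i (pos k) = j a - res e c%:Z by rewrite -wi //= residue_letter.
have psi0 : psi k * E i = 0.
  apply/psi_E0/eqP/negP => /negP /IH[[w' [wi' _]] _].
  have ww' := letters_agree wi wi'.
  have w'k : residues w' (pos k) = j a - res e c.+1%:Z.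
    by rewrite wi' // place_swapL ik ikE -addn1 PoszD resD opprD addrA.
  have [||w'a] := letter_of_residue w'k; [by rewrite /=; small_lia | by [] |].
  have -> : occ_before w' (pos k) = c.
    by apply/esym/eq_occ_before => s; rewrite -ltnS => /lt_pos[/ww'|->].
  by case; small_lia.
split=> //.
  apply: (prefix_word_extend (w := w) (a := a)) => //.
    rewrite residue_letter extend_next.
    have ea : extend w a (pos k) = extend w a (pos_next k).
      by rewrite extend_next extend_below.
    rewrite (occ_before_next ea) -addn1 PoszD resD opprD addrA ik ikE;
      congr (_ - res e _%:Z - _).
    by apply: eq_occ_before => s sk; rewrite extend_below.
  have ext p : (p < m.+2)%N -> exists2 q : 'I_n, (q < m.+1)%N & extend w a p = w q.
    by case/lt_next=> [pm|->]; [exists p; rewrite ?extend_below | exists (pos k);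
      rewrite ?extend_next].
  by move=> p q s /ext[p' p'm ->] /ext[q' q'm ->] /ext[s' s'm ->]; apply: two.
move=> p /lt_next[/yi //|->].
have := psi_sq i k; rewrite expr2 -mulrA psi0 mulr0.
have a1 : arrow (i (pos_next k)) (i (pos k)) by rewrite /arrow ik subrK.
rewrite a1; case: eqP => [/esym/eqP|_].
  by rewrite ik -subr_eq0 addrAC subrr sub0r oppr_eq0 => /eqP r0; move: res2;
    rewrite r0 addr0 eqxx.
by case: ifP => _ /esym/eqP; rewrite mulrBl (yi (pos k)) // ?subr0 ?sub0r ?oppr_eq0 => /eqP.
Qed.

(** The residue at m + 1 cannot be one above the residue at m.  For m = 0 this is a
    generator of the ideal.  If box m - 1 is in the column of box m, it already has this
    residue, both psi's kill e(i), and the braid relation gives e(i) = 0.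
    Otherwise it can be moved past the boxes m and m + 1, and the prefix which then ends
    in these two residues contradicts the induction hypothesis. *)
Lemma step_up i : E i != 0 -> i (pos_next k) <> i (pos k) + 1r.
Proof.
move=> Ei ik; have [[w [wi two]] yi] := IH Ei.
set a := w (pos k); pose c := occ_before w (pos k).
have cm : (c <= m)%N by apply: (occ_before_le w (pos k)).
have ikE : i (pos k) = j a - res e c%:Z by rewrite -wi //= residue_letter.
(* For c = 0 this is the formal depth -1. *)
have ikE' : i (pos_next k) = j a - res e (c%:Z - 1).
  by rewrite ik ikE resB opprB addrA addrAC.
have [m0|m0] := eqVneq m 0%N.
  case/eqP: (Ei); apply: (E_two (p := pos k) (q := pos_next k) _ _ _ ik) => //=;
    try by rewrite m0.
  by rewrite ikE; move: cm; rewrite m0 leqn0 => /eqP->; rewrite res0 subr0.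
have m_gt0 : (0 < m)%N by rewrite lt0n.
have mp : (m.-1 < n.-1)%N by apply: leq_ltn_trans (leq_pred m) lt_m_pred.
pose k1 : 'I_n.-1 := Ordinal mp.
have pk1 : pos_next k1 = pos k by apply: val_inj; rewrite /= prednK // lt0n.
have k1k : pos_next k != pos k1 by rewrite -val_eqE /=; small_lia.
have k1k' : pos_next k != pos_next k1 by rewrite pk1 eq_sym pos_neq.
have k1k'' : pos k1 != pos k by rewrite -pk1 pos_neq.
have k1m : (pos k1 < m)%N by rewrite /=; small_lia.
pose b := w (pos k1); pose d := occ_before w (pos k1).
have dm : (d <= m.-1)%N by apply: (occ_before_le w (pos k1)).
have ik1E : i (pos k1) = j b - res e d%:Z by rewrite -wi //= ?residue_letter //; small_lia.
have [ba|ba] := eqVneq b a.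
  have cd : c = d.+1 by rewrite /c -pk1; apply: occ_before_next; rewrite pk1.
  apply: (negP Ei); apply/eqP.
  apply: (psi_braid (k := k1) (l := k)).
  - by rewrite /= prednK // lt0n.
  - by rewrite ikE' ik1E ba cd; congr (_ - res e _); small_lia.
  - rewrite -pk1 in ikE ik *; rewrite ik1E ikE ba cd /arrow.
    apply/orP; right; rewrite -addn1 PoszD resD; apply/eqP.
    by rewrite opprD addrA subrK.
  - apply/psi_E0/eqP/negP => /negP /IH[[w' [wi' _]] _].
    have ag s : (s < m.-1)%N -> w s = w' s.
      move=> sm; have sm1 : (s < m.+1)%N by small_lia.
      have s1 : s != pos k1 by rewrite -val_eqE /=; small_lia.
      have s2 : s != pos_next k1 by rewrite -val_eqE /=; small_lia.
      by have [] := @letter_inj w w' s; rewrite ?wi ?wi' ?place_swapD.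
    have w'k : residues w' (pos k1) = j a - res e c%:Z.
      by rewrite wi' ?place_swapL ?pk1 ?ikE //=; small_lia.
    have [||w'a] := letter_of_residue w'k; [by rewrite /=; small_lia | by [] |].
    have -> : occ_before w' (pos k1) = d.
      apply/esym/eq_occ_before => s; rewrite leq_eqVlt => /predU1P[/val_inj->|/ag //].
      by rewrite -/b ba.
    by case; small_lia.
  - apply/psi_E0/eqP/negP => /negP /IH[[w' [wi' _]] _].
    have ww' := letters_agree wi wi'.
    have w'k : residues w' (pos k) = j a - res e (c%:Z - 1) by rewrite wi' // place_swapL.
    have [||w'a] := letter_of_residue w'k; [by rewrite /=; small_lia | by small_lia |].
    have -> : occ_before w' (pos k) = c.
      by apply/esym/eq_occ_before => s; rewrite -ltnS => /lt_pos[/ww'|->].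
    by small_lia.
have nl1 : ~~ linked (i (pos k1)) (i (pos_next k1)).
  by rewrite pk1 ik1E ikE; apply: linkedN => //; small_lia.
have Ei1 := E_swap_neq0 Ei nl1.
set i1 := place_swap k1 i in Ei1.
have i1k : i1 (pos k) = i (pos k1) by rewrite /i1 -pk1 place_swapR.
have i1k' : i1 (pos_next k) = i (pos_next k) by rewrite /i1 place_swapD.
have nl2 : ~~ linked (i1 (pos k)) (i1 (pos_next k)).
  by rewrite i1k i1k' ik1E ikE'; apply: linkedN => //; small_lia.
have [[w2 [wi2 _]] _] := IH (E_swap_neq0 Ei1 nl2).
have w2k1 : residues w2 (pos k1) = j a - res e c%:Z.
  rewrite wi2; last by rewrite /=; small_lia.
  by rewrite place_swapD ?k1k'' // 1?eq_sym // /i1 place_swapL pk1 ikE.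
have w2k : residues w2 (pos k) = j a - res e (c%:Z - 1).
  by rewrite wi2 // place_swapL i1k' ikE'.
have [||l1 c1] := letter_of_residue w2k1; [by rewrite /=; small_lia | by [] |].
move: w2k; rewrite residue_letter => /label_inj[|l2 c2].
  by have := occ_before_le w2 (pos k); rewrite /=; small_lia.
have : occ_before w2 (pos k) = (occ_before w2 (pos k1)).+1.
  by rewrite -pk1; apply: occ_before_next; rewrite pk1 l1 l2.
by small_lia.
Qed.

Lemma step i : E i != 0 -> prefix_word m.+2 i /\ (forall p, (p < m.+2)%N -> y p * E i = 0).
Proof.
move=> Ei; have [|] := boolP (linked (i (pos k)) (i (pos_next k)));
  last exact: step_unlinked.
case/or3P=> [/eqP/(step_equal Ei)//|/eqP/(step_up Ei)//|/eqP ik].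
by have [] := step_down Ei; rewrite ?ik ?addrK.
Qed.
End Step.

Lemma E_neq0_prefix_word m : (m < n)%N -> forall i, E i != 0 ->
  prefix_word m.+1 i /\ (forall p, (p < m.+1)%N -> y p * E i = 0).
Proof.
elim: m => [|m IHm] mn i Ei; last by apply: step Ei => // i'; apply: IHm; apply: ltnW.
have [a ia ya] := E_first (p := Ordinal mn) erefl Ei.
have p_eq p : (p < 1)%N -> p = Ordinal mn by rewrite ltnS leqn0 => /eqP p0; apply: val_inj.
split; last by move=> p /p_eq->.
exists [ffun=> a]; split=> [p /p_eq->|p q s _ _ _]; last by rewrite !ffunE uniq3 eqxx.
rewrite residue_letter ffunE ia occ_before_eq0 ?res0 ?subr0 // => s.
Qed.

(** * Paths between words and simple left ideals *)

Hypothesis n_pos : (0 < n)%N.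
Hypothesis E_E : forall i i', E i * E i' = if i == i' then E i else 0.
Hypothesis psi_psi : forall k l, k.+1 != l -> l.+1 != k -> psi k * psi l = psi l * psi k.

Definition two_letters w := forall p q s, ~~ uniq [:: w p; w q; w s].

Lemma residues_inj : injective (residues : 'I_r ^ n -> I ^ n).
Proof. by move=> w w' ww; apply/ffunP => p; have [] := @letter_inj w w' p; rewrite ?ww. Qed.

Lemma E_neq0_word i : E i != 0 ->
  exists w, [/\ residues w = i, two_letters w & forall p, y p * E i = 0].
Proof.
have n1 : (n.-1 < n)%N by rewrite prednK.
have all_lt p : (p < n.-1.+1)%N by rewrite prednK.
move=> /(E_neq0_prefix_word n1)[[w [wi two]] yi]; exists w; split=> [|p q s|p].
- by apply/ffunP => p; apply: wi.
- exact: two.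
- exact: yi.
Qed.

Lemma E_neq0_two w : E (residues w) != 0 -> two_letters w.
Proof. by move=> /E_neq0_word[w' [/residues_inj-> ]]. Qed.

Lemma y_E0 p i : y p * E i = 0.
Proof.
have [->|/E_neq0_word[w [_ _ ->]] //] := eqVneq (E i) 0.
by rewrite mulr0.
Qed.

Lemma psi_same k w : w (pos k) = w (pos_next k) -> psi k * E (residues w) = 0.
Proof.
move=> wk; have [->|Ew] := eqVneq (E (residues w)) 0; first by rewrite mulr0.
have kn : (k.+1 < n)%N := ltn_ord (pos_next k).
have kE : k = Ordinal (lt_m_pred kn) by apply: val_inj.
have [|_ _] := @step_down k kn (E_neq0_prefix_word (ltnW kn)) (residues w) Ew.
  by rewrite -kE !residue_letter (occ_before_next wk) -wk -addn1 PoszD resD opprD addrA.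
by rewrite -kE.
Qed.

Lemma unlinked_word k w : w (pos k) != w (pos_next k) ->
  ~~ linked (residues w (pos k)) (residues w (pos_next k)).
Proof.
move=> wk; rewrite !residue_letter; apply: linkedN => //.
have := occ_before_le w (pos k); have := occ_before_le (place_swap k w) (pos k).
rewrite occ_before_swap // tpermL /=; have := ltn_ord (pos_next k) => /=; small_lia.
Qed.

Lemma psi_psi_E k w : w (pos k) != w (pos_next k) ->
  psi k * psi k * E (residues w) = E (residues w).
Proof. by move=> /unlinked_word; apply: psi_sqN. Qed.

Lemma E_swap_word k w : w (pos k) != w (pos_next k) -> E (residues w) != 0 ->
  E (residues (place_swap k w)) != 0.
Proof. by move=> wk Ew; rewrite word_residues_swap //; apply/E_swap_neq0/unlinked_word. Qed.

Definition descent k w := (w (pos_next k) < w (pos k))%N.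

Lemma descent_neq k w : descent k w -> w (pos k) != w (pos_next k).
Proof. by rewrite /descent -val_eqE neq_ltn orbC => ->. Qed.

(** Sorting moves large letters to the right, so this weighted sum decreases with
    every removal of a descent. *)
Definition height w := (\sum_(p < n) (n - p) * w p)%N.

Lemma height_swap k w : descent k w -> (height (place_swap k w) < height w)%N.
Proof.
rewrite /descent => dk; have kn : (k.+1 < n)%N := ltn_ord (pos_next k).
rewrite /height (bigD1 (pos k)) // (bigD1 (pos_next k)) /=; last by rewrite eq_sym pos_neq.
rewrite [X in (_ < X)%N](bigD1 (pos k)) // [X in (_ < _ + X)%N](bigD1 (pos_next k)) /=;
  last first.
  by rewrite eq_sym pos_neq.
rewrite place_swapL place_swapR !addnA.
set S1 := (X in (_ + X < _)%N); set S2 := (X in (_ < _ + X)%N).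
have -> : S1 = S2 by apply: eq_bigr => p /andP[p1 p2]; rewrite place_swapD.
rewrite ltn_add2r -(subnSK (ltnW kn)).
by move: dk; move: (w (pos k) : nat) (w (pos_next k) : nat) (n - k.+1)%N => u v d; nia.
Qed.

(** The product of the psi's that sort the word, together with the sorted word; the
    fuel [m] is enough when it is at least the height. *)
Fixpoint walk m w : Q * ('I_r ^ n) :=
  if m is m'.+1 then
    if [pick k | descent k w] is Some k
    then (psi k * (walk m' (place_swap k w)).1, (walk m' (place_swap k w)).2)
    else (E (residues w), w)
  else (E (residues w), w).

Lemma walk_stable m m' w : (height w <= m)%N -> (height w <= m')%N -> walk m w = walk m' w.
Proof.
elim: m m' w => [|m IHm] m' w.
  rewrite leqn0 => /eqP h0 _; case: m' => //= m'; case: pickP => // k /height_swap.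
  by rewrite h0.
case: m' => [_|m' hm hm'] /=.
  rewrite leqn0 => /eqP h0; case: pickP => // k /height_swap.
  by rewrite h0.
case: pickP => // k /height_swap hk.
by rewrite (IHm m') // -ltnS (leq_trans hk).
Qed.

Definition word_path w := (walk (height w) w).1.
Definition path_base w := (walk (height w) w).2.

Lemma word_path_rec w :
  (exists k, [/\ descent k w, word_path w = psi k * word_path (place_swap k w) &
                  path_base w = path_base (place_swap k w)]) \/
  [/\ forall k, ~~ descent k w, word_path w = E (residues w) & path_base w = w].
Proof.
rewrite /word_path /path_base (@walk_stable _ (height w).+1 w) //=.
case: pickP => [k dk|no_d]; [left; exists k | by right; split=> // k; rewrite no_d].
by rewrite (@walk_stable (height w) (height (place_swap k w))) // ltnW ?height_swap.
Qed.

Lemma height_ind (P : 'I_r ^ n -> Prop) :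
  (forall w, (forall k, descent k w -> P (place_swap k w)) -> P w) -> forall w, P w.
Proof.
move=> indP w; have [m] := ubnP (height w); elim: m w => // m IHm w hm.
by apply: indP => k dk; apply: IHm; apply: leq_trans (height_swap dk) _.
Qed.

Lemma word_path_left w : E (residues w) * word_path w = word_path w.
Proof.
elim/height_ind: w => w IHw; have [[k [dk -> _]]|[_ -> _]] := word_path_rec w.
  rewrite -IHw // !mulrA; congr (_ * _).
  rewrite word_residues_swap ?descent_neq // -{1}[residues w](place_swapK k) -psi_E.
  by rewrite -mulrA E_E eqxx.
by rewrite E_E eqxx.
Qed.

Lemma word_path_right w : word_path w * E (residues (path_base w)) = word_path w.
Proof.
elim/height_ind: w => w IHw; have [[k [dk -> ->]]|[_ -> ->]] := word_path_rec w.
  by rewrite -mulrA IHw.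
by rewrite E_E eqxx.
Qed.

Lemma word_path_inv w : exists b : Q, b * word_path w = E (residues (path_base w)) /\
  word_path w * b = E (residues w).
Proof.
elim/height_ind: w => w IHw; have [[k [dk -> ->]]|[_ -> ->]] := word_path_rec w; last first.
  by exists (E (residues w)); rewrite E_E eqxx.
have wk := descent_neq dk.
have wk' : place_swap k w (pos k) != place_swap k w (pos_next k).
  by rewrite place_swapL place_swapR eq_sym.
have [b [bl br]] := IHw k dk; exists (b * psi k); split.
  rewrite -word_path_left !mulrA -(mulrA b) -(mulrA b) psi_psi_E //.
  by rewrite -mulrA word_path_left.
rewrite mulrA -(mulrA (psi k)) br psi_E -mulrA word_residues_swap // place_swapK.
by rewrite -{1}[residues w](place_swapK k) mulrA -psi_E -mulrA -psi_E mulrA psi_psi_E.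
Qed.

(** By induction on the height.  A descent k other than the chosen descent k0 is not
    adjacent to it, as u_k > u_(k+1) > u_(k+2) would need three letters; so both can
    be removed in either order, and the corresponding psi's commute. *)
Lemma word_path_descent k w : E (residues w) != 0 -> descent k w ->
  word_path w = psi k * word_path (place_swap k w).
Proof.
elim/height_ind: w k => w IHw k Ew dk.
have [[k0 [dk0 pw _]]|[/(_ k)/negP//]] := word_path_rec w.
have [->//|kk0] := eqVneq k k0.
have two := E_neq0_two Ew.
have far k1 k2 : descent k1 w -> descent k2 w -> k1.+1 != k2.
  move=> d1 d2; apply/eqP => k12.
  have p12 : pos_next k1 = pos k2 by apply: val_inj.
  have := two (pos k1) (pos k2) (pos_next k2); rewrite uniq3.
  rewrite -{1}p12 (descent_neq d1) (descent_neq d2) andbT /=.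
  by move: d1 d2; rewrite /descent p12 -val_eqE /= => d1 d2;
    rewrite gtn_eqF // (ltn_trans d2).
have f1 := far _ _ dk dk0; have f2 := far _ _ dk0 dk.
have [p1 p2 p3 p4] : [/\ pos k != pos k0, pos k != pos_next k0,
    pos_next k != pos k0 & pos_next k != pos_next k0].
  by split; rewrite -val_eqE //= 1?eq_sym.
have dk' : descent k (place_swap k0 w) by rewrite /descent !place_swapD.
have dk0' : descent k0 (place_swap k w).
  by rewrite /descent !place_swapD // eq_sym.
rewrite pw (IHw k0 dk0 k) //; last by apply: E_swap_word => //; apply: descent_neq.
rewrite (IHw k dk k0) //; last by apply: E_swap_word => //; apply: descent_neq.
by rewrite place_swap_comm // !mulrA psi_psi.
Qed.

Variable (R : fieldType) (sc : R -> Q).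
Hypothesis sc1 : sc 1 = 1.
Hypothesis scD : forall x z, sc (x + z) = sc x + sc z.
Hypothesis scM : forall x z, sc (x * z) = sc x * sc z.
Hypothesis scC : forall x z, sc x * z = z * sc x.

Lemma sc0 : sc 0 = 0.
Proof. by apply: (addrI (sc 0)); rewrite -scD !addr0. Qed.

Definition path_span x := exists c : 'I_r ^ n -> R, x = \sum_w sc (c w) * word_path w.

Lemma path_span0 : path_span 0.
Proof. by exists (fun=> 0); rewrite big1 // => w _; rewrite sc0 mul0r. Qed.

Lemma path_spanD x z : path_span x -> path_span z -> path_span (x + z).
Proof.
move=> [c ->] [d ->]; exists (fun w => c w + d w); rewrite -big_split.
by apply: eq_bigr => w _; rewrite scD mulrDl.
Qed.

Lemma path_spanZ (a : R) x : path_span x -> path_span (sc a * x).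
Proof.
move=> [c ->]; exists (fun w => a * c w); rewrite mulr_sumr.
by apply: eq_bigr => w _; rewrite scM mulrA.
Qed.

Lemma path_span_path w : path_span (word_path w).
Proof.
exists (fun v => (v == w)%:R); rewrite (bigD1 w) //= eqxx sc1 mul1r big1 ?addr0 // => v vw.
by rewrite (negPf vw) sc0 mul0r.
Qed.

Definition preserves_span x := forall w, path_span (x * word_path w).

Lemma preserves_spanD x z : preserves_span x -> preserves_span z -> preserves_span (x + z).
Proof. by move=> px pz w; rewrite mulrDl; apply: path_spanD. Qed.

Lemma preserves_spanM x z : preserves_span x -> preserves_span z -> preserves_span (x * z).
Proof.
move=> px pz w; rewrite -mulrA; have [c ->] := pz w; rewrite mulr_sumr.
elim/big_ind: _ => [||v _]; [exact: path_span0 | exact: path_spanD |].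
by rewrite mulrA -scC -mulrA; apply: path_spanZ.
Qed.

Lemma preserves_span_sc (a : R) : preserves_span (sc a).
Proof. by move=> w; apply/path_spanZ/path_span_path. Qed.

Lemma preserves_span_E i : preserves_span (E i).
Proof.
move=> w; rewrite -word_path_left mulrA E_E; case: eqP => [->|_].
  by rewrite word_path_left; apply: path_span_path.
by rewrite mul0r; apply: path_span0.
Qed.

Lemma preserves_span_y p : preserves_span (y p).
Proof. by move=> w; rewrite -word_path_left mulrA y_E0 mul0r; apply: path_span0. Qed.

(** Along a descent or an ascent psi_k moves between canonical paths, because psi_k^2
    is the identity between different letters. *)
Lemma preserves_span_psi k : preserves_span (psi k).
Proof.
move=> w; have [E0|Ew] := eqVneq (E (residues w)) 0.
  by rewrite -word_path_left E0 mul0r mulr0; apply: path_span0.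
have [wk|wk] := eqVneq (w (pos k)) (w (pos_next k)).
  by rewrite -word_path_left mulrA psi_same // mul0r; apply: path_span0.
suff -> : psi k * word_path w = word_path (place_swap k w) by apply: path_span_path.
have [dk|dk] := boolP (descent k w).
  rewrite (word_path_descent Ew dk) -word_path_left !mulrA psi_psi_E //.
  by rewrite place_swapL place_swapR eq_sym.
have Es := E_swap_word wk Ew.
rewrite (@word_path_descent k (place_swap k w)) ?place_swapK //.
rewrite /descent place_swapL place_swapR.
by move: dk; rewrite /descent -leqNgt leq_eqVlt val_eqE (negPf wk).
Qed.

(** Generation is stated for the left ideals at the idempotents: an element of the
    infinite product of the orbit algebras is a polynomial in the generators one orbit
    at a time. *)
Hypothesis generation : forall P : Q -> Prop,
  (forall a : R, P (sc a)) -> (forall i, P (E i)) -> (forall k, P (psi k)) ->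
    (forall p, P (y p)) ->
  (forall x z, P x -> P z -> P (x + z)) -> (forall x z, P x -> P z -> P (x * z)) ->
  forall x i, exists2 F, P F & x * E i = F * E i.

Lemma path_span_mul (x : Q) w : path_span (x * word_path w).
Proof.
have [F pF xF] := generation preserves_span_sc preserves_span_E preserves_span_psi
  preserves_span_y preserves_spanD preserves_spanM x (residues w).
by rewrite -word_path_left mulrA xF -mulrA word_path_left.
Qed.

Variable B : seq (I ^ n).
Hypothesis B_uniq : uniq B.
Hypothesis sum_E : \sum_(i <- B) E i = 1.

(** Some component e(u) x e(i) is nonzero; it is a scalar multiple of an invertible
    path. *)
Lemma left_inverse_E x i : x * E i != 0 -> exists z, z * (x * E i) = E i.
Proof.
move=> xE; have Ei : E i != 0 by apply: contraNneq xE => ->; rewrite mulr0.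
have [w [wi _ _]] := E_neq0_word Ei.
have [b [_ br]] := word_path_inv w; rewrite wi in br.
have xp : x * word_path w != 0.
  by apply: contraNneq xE => xp; rewrite -br mulrA xp mul0r.
have [u ux] : exists u, E (residues u) * (x * word_path w) != 0.
  apply: contrapT => no_u; case/eqP: xp.
  rewrite -[x * _]mul1r -sum_E mulr_suml big1_seq // => v _.
  have [->|Ev] := eqVneq (E v) 0; first by rewrite mul0r.
  have [u [uv _ _]] := E_neq0_word Ev.
  by apply/eqP; apply: contrapT => /negP vx; apply: no_u; exists u; rewrite uv.
have [c xc] := path_span_mul x w.
have ucE : E (residues u) * (x * word_path w) = sc (c u) * word_path u.
  rewrite xc mulr_sumr (bigD1 u) //= mulrA -scC -mulrA word_path_left big1 ?addr0 // => v
    vu.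
  rewrite mulrA -scC -mulrA -word_path_left [E (residues u) * _]mulrA E_E;
    case: eqP => [/residues_inj uv|_].
    by rewrite uv eqxx in vu.
  by rewrite mul0r mulr0.
have c0 : c u != 0 by apply: contraNneq ux => c0; rewrite ucE c0 sc0 mul0r.
have scK z : sc (c u)^-1 * (sc (c u) * z) = z by rewrite mulrA -scM mulVf // sc1 mul1r.
have pu : word_path u * E (residues (path_base w)) = word_path u.
  by rewrite -[word_path u]scK -ucE -!mulrA word_path_right.
have same_base : path_base u = path_base w.
  apply/eqP; apply: contraNT ux => /negPf bb.
  rewrite ucE -pu -word_path_right -mulrA E_E (inj_eq residues_inj) bb !mulr0 //.
have [b' [bl' _]] := word_path_inv u.
exists (word_path w * (b' * (sc (c u)^-1 * E (residues u)))).
have -> : word_path w * (b' * (sc (c u)^-1 * E (residues u))) * (x * E i) =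
    word_path w * (b' * (sc (c u)^-1 * (E (residues u) * (x * word_path w)))) * b by
      rewrite -br !mulrA.
by rewrite ucE scK bl' same_base word_path_right br.
Qed.

(** The left ideals Q e(i) with e(i) nonzero are simple by [left_inverse_E], and their
    sum is direct because the idempotents are orthogonal. *)
Theorem semisimple_of_presentation : semisimple Q.
Proof.
pose S := [seq i <- B | E i != 0]; pose m := size S.
pose s (k : 'I_m) := tnth (in_tuple S) k.
have s_neq0 (k : 'I_m) : E (s k) != 0 by have := mem_tnth k (in_tuple S);
  rewrite mem_filter => /andP[].
have s_inj : injective s by apply/tuple_uniqP; rewrite filter_uniq.
have sum_s : \sum_(k < m) E (s k) = 1.
  rewrite -sum_E -(big_tnth _ _ S predT E) big_filter [RHS](bigID (fun i => E i != 0)) /=.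
  by rewrite [X in _ + X]big1 ?addr0 // => i /negbNE/eqP.
exists m, (fun (k : 'I_m) (x : Q) => x * E (s k) = x); split=> [k|a].
  split.
  - split=> [|x z xs zs|a x xs]; first by rewrite mul0r.
      by rewrite mulrDl xs zs.
    by rewrite -mulrA xs.
  - by exists (E (s k)) => //; rewrite E_E eqxx.
  move=> M [M0 MD MM] MI; have [[x Mx x0]|no_x] := pselect (exists2 x, M x & x != 0).
    right=> z zs; have xs := MI x Mx; rewrite -xs in x0.
    have [v vx] := left_inverse_E x0; rewrite -zs -vx xs mulrA.
    exact: MM.
  by left=> x Mx; apply/eqP; apply: contrapT => /negP x0; apply: no_x; exists x.
exists [ffun k : 'I_m => a * E (s k)]; split.
  split=> [k|]; first by rewrite ffunE -mulrA E_E eqxx.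
  rewrite (eq_bigr (fun k : 'I_m => a * E (s k))); last by move=> k _; rewrite ffunE.
  by rewrite -mulr_sumr sum_s mulr1.
move=> x [xs ax]; apply/ffunP => k; rewrite ffunE ax mulr_suml (bigD1 k) //= xs.
rewrite big1 ?addr0 // => l lk; rewrite -xs -mulrA E_E (inj_eq s_inj) (negPf lk).
by rewrite mulr0.
Qed.
End Separated.

(** * Distances of residues *)

Section Distance.
Variable e : nat.
Implicit Types (a b : residue e) (x z : int).

Lemma res_surj a : exists x, a = res e x.
Proof. by exists (repr a); rewrite /res reprK. Qed.

Lemma residue_dist_le x z : (residue_dist (res e x) (res e z) <= `|x - z|)%N.
Proof.
rewrite /residue_dist; case: ex_minnP => m _; apply.
by apply/asboolP; exists x, z.
Qed.

Lemma residue_distP a b :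
  exists x z, [/\ res e x = a, res e z = b & residue_dist a b = `|x - z|%N].
Proof. by rewrite /residue_dist; case: ex_minnP => m /asboolP. Qed.

Lemma residue_dist_shift a b z : a = b + res e z ->
  (residue_dist a b <= `|z|)%N /\ (residue_dist b a <= `|z|)%N.
Proof.
have [x ->] := res_surj b; rewrite -resD => ->; split.
  by apply: leq_trans (residue_dist_le _ _) _; lia.
by apply: leq_trans (residue_dist_le _ _) _; lia.
Qed.

(** Shifting a closest pair of representatives by a multiple z of e, in either
    direction, cannot bring it closer, so |z| is at least twice the distance. *)
Lemma res_eq0_large a b z : res e z = 0 -> z != 0 -> ((residue_dist a b).*2 <= `|z|)%N.
Proof.
move=> z0 zn; have [x [x' [<- <- D]]] := residue_distP a b.
have h1 := residue_dist_le (x + z) x'; have h2 := residue_dist_le (x - z) x'.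
by move: h1 h2; rewrite resB resD z0 addr0 subr0 D; lia.
Qed.
End Distance.

Section WeightSum.
Variables (e r : nat) (j : 'I_r -> residue e).

Lemma weight_sum_gt0 u : (0 < weight_sum j u)%N -> exists a, j a = u.
Proof.
move=> w0; apply: contrapT => no_a; move: w0; rewrite /weight_sum big1 // => a _.
by rewrite /fundamental; case: eqP => // ja; case: no_a; exists a.
Qed.

Lemma weight_sum_start a : injective j -> weight_sum j (j a) = 1%N.
Proof.
move=> j_inj; rewrite /weight_sum (bigD1 a) //= /fundamental eqxx big1 // => b ba.
by rewrite (inj_eq j_inj) (negPf ba).
Qed.
End WeightSum.

(** * The Temperley-Lieb quotient as a presented ring *)

Section Presentation.
Variables (R : fieldType) (e n r : nat) (j : 'I_r -> residue e).
Local Notation L := (weight_sum j).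
Local Notation I := (residue e).
Local Notation pi O := (quot_proj (relator L (O := O))).
Local Notation TL := (TL R n L).
Hypothesis j_inj : injective j.

Definition KLR_psi (k : 'I_n.-1) : KLR R n L := fun O => pi O (gen R (Psi O k)).
Definition KLR_y (p : 'I_n) : KLR R n L := fun O => pi O (gen R (Y O p)).
Definition KLR_scalar (c : R) : KLR R n L := fun O => pi O c%:MP.

Definition to_TL : KLR R n L -> TL := quot_proj (@TL_generator R e n L).
Definition TL_e i : TL := to_TL (KLR_e R L i).
Definition TL_psi k : TL := to_TL (KLR_psi k).
Definition TL_y p : TL := to_TL (KLR_y p).
Definition TL_scalar c : TL := to_TL (KLR_scalar c).

Lemma to_TLD x y : to_TL (x + y) = to_TL x + to_TL y.
Proof. exact: rmorphD. Qed.
Lemma to_TLB x y : to_TL (x - y) = to_TL x - to_TL y.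
Proof. exact: rmorphB. Qed.
Lemma to_TLN x : to_TL (- x) = - to_TL x.
Proof. exact: rmorphN. Qed.
Lemma to_TLM x y : to_TL (x * y) = to_TL x * to_TL y.
Proof. exact: rmorphM. Qed.
Lemma to_TL1 : to_TL 1 = 1.
Proof. exact: rmorph1. Qed.
Lemma to_TL0 : to_TL 0 = 0.
Proof. exact: rmorph0. Qed.

Lemma gen_e_out (O : perm_orbit n I) i : i \notin orbit_set O -> gen_e R O i = 0.
Proof. by move=> Oi; rewrite /gen_e insubN. Qed.

Lemma place_swap_out (O : perm_orbit n I) k i :
  i \notin orbit_set O -> place_swap k i \notin orbit_set O.
Proof. by apply: contra => /(mem_place_swap k); rewrite place_swapK. Qed.

(** Equations between multiples of e(i) only need to be checked in the orbit of i. *)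
Lemma KLR_eq_at (x y : KLR R n L) i :
  (forall O, i \in orbit_set O -> x O = y O) ->
  (forall O, i \notin orbit_set O -> x O = 0) ->
  (forall O, i \notin orbit_set O -> y O = 0) -> x = y.
Proof.
move=> xy x0 y0; apply: prod_ringP => O.
by have [/xy//|Oi] := boolP (i \in orbit_set O); rewrite x0 ?y0.
Qed.

Lemma KLR_e_out (O : perm_orbit n I) i : i \notin orbit_set O -> KLR_e R L i O = 0.
Proof. by move=> Oi; rewrite /KLR_e /orbit_e gen_e_out // rmorph0. Qed.

Lemma TL_e_TL_e i i' : TL_e i * TL_e i' = if i == i' then TL_e i else 0.
Proof.
rewrite /TL_e -to_TLM -to_TL0 -(fun_if to_TL); congr to_TL.
apply: (@KLR_eq_at _ _ i) => O Oi; last 2 first.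
- by rewrite [LHS](_ : _ = KLR_e R L i O * KLR_e R L i' O) // KLR_e_out // mul0r.
- by case: ifP => // _; rewrite KLR_e_out.
have [Oi'|Oi'] := boolP (i' \in orbit_set O).
  transitivity (pi O (gen_e R O i * gen_e R O i')); first by rewrite rmorphM.
  rewrite (KLR_relP (rel_ee R L Oi Oi')).
  by case: ifP => // _; rewrite rmorph0.
rewrite [LHS](_ : _ = KLR_e R L i O * KLR_e R L i' O) // [X in _ * X]KLR_e_out // mulr0.
by case: eqP => // ii'; rewrite -ii' Oi in Oi'.
Qed.

Lemma TL_psi_e k i : TL_psi k * TL_e i = TL_e (place_swap k i) * TL_psi k.
Proof.
rewrite -!to_TLM; congr to_TL; apply: (@KLR_eq_at _ _ i) => O Oi.
- transitivity (pi O (gen R (Psi O k) * gen_e R O i)); first by rewrite rmorphM.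
  by rewrite (KLR_relP (rel_psie R L k Oi)) rmorphM.
- by rewrite [LHS](_ : _ = KLR_psi k O * KLR_e R L i O) // KLR_e_out // mulr0.
- rewrite [LHS](_ : _ = KLR_e R L (place_swap k i) O * KLR_psi k O) // KLR_e_out ?mul0r //.
  exact: place_swap_out.
Qed.

Lemma TL_e_y i p : TL_e i * TL_y p = TL_y p * TL_e i.
Proof.
rewrite -!to_TLM; congr to_TL; apply: (@KLR_eq_at _ _ i) => O Oi.
- transitivity (pi O (gen_e R O i * gen R (Y O p))); first by rewrite rmorphM.
  by rewrite (KLR_relP (rel_ey R L p Oi)) rmorphM.
- by rewrite [LHS](_ : _ = KLR_e R L i O * KLR_y p O) // KLR_e_out // mul0r.
- by rewrite [LHS](_ : _ = KLR_y p O * KLR_e R L i O) // KLR_e_out // mulr0.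
Qed.

Lemma TL_psi_psi (k l : 'I_n.-1) : k.+1 != l -> l.+1 != k ->
  TL_psi k * TL_psi l = TL_psi l * TL_psi k.
Proof.
move=> kl lk; rewrite -!to_TLM; congr to_TL; apply: prod_ringP => O.
transitivity (pi O (gen R (Psi O k) * gen R (Psi O l))); first by rewrite rmorphM.
by rewrite (KLR_relP (rel_psipsi R L O kl lk)) rmorphM.
Qed.

Lemma TL_cyclotomic (i : I ^ n) (p : 'I_n) : p = 0%N :> nat ->
  TL_y p ^+ L (i p) * TL_e i = 0.
Proof.
move=> p0; have -> : TL_y p ^+ L (i p) = to_TL (fun O => pi O (gen R (Y O p) ^+ L (i p))).
  elim: (L _) => [|m IHm]; first by rewrite expr0 -to_TL1; congr to_TL;
    apply: prod_ringP => O; rewrite rmorph1.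
  rewrite exprS IHm -to_TLM; congr to_TL; apply: prod_ringP => O.
  by rewrite exprS rmorphM.
rewrite -to_TLM -to_TL0; congr to_TL; apply: prod_ringP => O.
transitivity (pi O (gen R (Y O p) ^+ L (i p) * gen_e R O i)); first by rewrite rmorphM.
have [Oi|Oi] := boolP (i \in orbit_set O); last by rewrite gen_e_out // mulr0 rmorph0.
by rewrite (KLR_relP (rel_cyclotomic R L Oi p0)) rmorph0.
Qed.

Lemma TL_e_first (i : I ^ n) (p : 'I_n) : p = 0%N :> nat -> TL_e i != 0 ->
  exists2 a, i p = j a & TL_y p * TL_e i = 0.
Proof.
move=> p0 Ei; have := TL_cyclotomic i p0.
have [L0|L_pos] := posnP (L (i p)).
  by rewrite L0 expr0 mul1r => E0; rewrite E0 eqxx in Ei.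
have [a ja] := weight_sum_gt0 L_pos; rewrite -ja weight_sum_start // expr1.
by exists a.
Qed.

Lemma TL_psi_sq i k : TL_psi k ^+ 2 * TL_e i =
  if i (pos k) == i (pos_next k) then 0
  else if arrow (i (pos k)) (i (pos_next k)) then (TL_y (pos_next k) - TL_y (pos k)) * TL_e
    i
  else if arrow (i (pos_next k)) (i (pos k)) then (TL_y (pos k) - TL_y (pos_next k)) * TL_e
    i
  else TL_e i.
Proof.
transitivity (to_TL (fun O => pi O (psi_square R O k i))).
  rewrite expr2 -!to_TLM; congr to_TL; apply: prod_ringP => O.
  transitivity (pi O (gen R (Psi O k) ^+ 2 * gen_e R O i)).
    by rewrite expr2 2!rmorphM.
  have [Oi|Oi] := boolP (i \in orbit_set O);
    first by rewrite (KLR_relP (rel_square R L k Oi)).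
  have -> : psi_square R O k i = 0.
    rewrite /psi_square gen_e_out //.
    by case: ifP => // _; case: ifP => _; [|case: ifP => // _]; rewrite mulr0.
  by rewrite gen_e_out // mulr0.
rewrite /psi_square; case: ifP => _.
  by rewrite -to_TL0; congr to_TL; apply: prod_ringP => O; rewrite rmorph0.
case: ifP => _.
  by rewrite -to_TLB -to_TLM; congr to_TL; apply: prod_ringP => O; rewrite rmorphM rmorphB.
case: ifP => _ //.
by rewrite -to_TLB -to_TLM; congr to_TL; apply: prod_ringP => O; rewrite rmorphM rmorphB.
Qed.

Lemma TL_nat m : to_TL (fun O => pi O m%:R) = m%:R.
Proof.
elim: m => [|m IHm].
  by rewrite [RHS]mulr0n -to_TL0; congr to_TL; apply: prod_ringP => O;
    rewrite mulr0n rmorph0.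
rewrite -addn1 natrD -IHm -to_TL1 -to_TLD; congr to_TL; apply: prod_ringP => O.
by rewrite natrD rmorphD rmorph1.
Qed.

Lemma TL_psi_y_next i k : TL_psi k * TL_y (pos_next k) * TL_e i =
  (TL_y (pos k) * TL_psi k + (i (pos k) == i (pos_next k))%:R) * TL_e i.
Proof.
rewrite -TL_nat -!to_TLM -to_TLD -to_TLM; congr to_TL; apply: (@KLR_eq_at _ _ i) => O Oi.
- transitivity (pi O (gen R (Psi O k) * gen R (Y O (pos_next k)) * gen_e R O i)).
    by rewrite 2!rmorphM.
  by rewrite (KLR_relP (rel_psiy_next R L k Oi)) rmorphM rmorphD rmorphM.
- by rewrite [LHS](_ : _ = KLR_psi k O * KLR_y (pos_next k) O * KLR_e R L i O) // KLR_e_out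
    // mulr0.
- by rewrite [LHS](_ : _ = (KLR_y (pos k) O * KLR_psi k O + pi O (i (pos k) == i (pos_next
    k))%:R)
    * KLR_e R L i O) // KLR_e_out // mulr0.
Qed.

Lemma TL_y_next_psi i k : TL_y (pos_next k) * TL_psi k * TL_e i =
  (TL_psi k * TL_y (pos k) + (i (pos k) == i (pos_next k))%:R) * TL_e i.
Proof.
rewrite -TL_nat -!to_TLM -to_TLD -to_TLM; congr to_TL; apply: (@KLR_eq_at _ _ i) => O Oi.
- transitivity (pi O (gen R (Y O (pos_next k)) * gen R (Psi O k) * gen_e R O i)).
    by rewrite 2!rmorphM.
  by rewrite (KLR_relP (rel_ypsi_next R L k Oi)) rmorphM rmorphD rmorphM.
- by rewrite [LHS](_ : _ = KLR_y (pos_next k) O * KLR_psi k O * KLR_e R L i O) // KLR_e_out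
    // mulr0.
- by rewrite [LHS](_ : _ = (KLR_psi k O * KLR_y (pos k) O + pi O (i (pos k) == i (pos_next
    k))%:R)
    * KLR_e R L i O) // KLR_e_out // mulr0.
Qed.

Lemma TL_psi_braid (i : I ^ n) (k l : 'I_n.-1) : l = k.+1 :> nat ->
  i (pos_next l) = i (pos k) ->
  arrow (i (pos k)) (i (pos l)) || arrow (i (pos l)) (i (pos k)) ->
  TL_psi k * TL_e i = 0 -> TL_psi l * TL_e i = 0 -> TL_e i = 0.
Proof.
move=> lk ii ar psi_k psi_l.
have pi3 O (a b c : free_alg R O) : pi O (a * b * c) = pi O a * pi O b * pi O c.
  by rewrite 2!rmorphM.
have distr (a b c : TL) : (a * b * a - b * a * b) * c = a * b * (a * c) - b * a * (b * c).
  by rewrite mulrBl !mulrA.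
have braid : (TL_psi k * TL_psi l * TL_psi k - TL_psi l * TL_psi k * TL_psi l) * TL_e i
    = to_TL (fun O => pi O (psi_braid R O k l i)).
  rewrite -!to_TLM -to_TLB -to_TLM; congr to_TL; apply: (@KLR_eq_at _ _ i) => O Oi.
  - transitivity (pi O ((gen R (Psi O k) * gen R (Psi O l) * gen R (Psi O k)
        - gen R (Psi O l) * gen R (Psi O k) * gen R (Psi O l)) * gen_e R O i)).
      rewrite rmorphM rmorphB; congr ((_ - _) * _); exact/esym/pi3.
    by rewrite (KLR_relP (rel_braid R L Oi lk)).
  - by rewrite [LHS](_ : _ = (KLR_psi k O * KLR_psi l O * KLR_psi k O
      - KLR_psi l O * KLR_psi k O * KLR_psi l O) * KLR_e R L i O) // KLR_e_out // mulr0.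
  - by rewrite /psi_braid gen_e_out // oppr0 !if_same rmorph0.
move: braid; rewrite distr psi_k psi_l !mulr0 subrr /psi_braid ii eqxx /=.
case: (arrow (i (pos k)) _) ar => /= ar; first by move=> e0; symmetry.
rewrite ar => neg_e; apply: oppr_inj; rewrite oppr0 [RHS]neg_e -to_TLN.
by congr to_TL; apply: prod_ringP => O; rewrite rmorphN.
Qed.

Lemma TL_generator0 i : TL_generator (KLR_e R L i) -> TL_e i = 0.
Proof.
move=> gi; rewrite -to_TL0; apply/eqP/quot_eqP; rewrite subr0.
exact: generated_ideal_gen.
Qed.

Lemma TL_e_two (i : I ^ n) (p q : 'I_n) : p = 0%N :> nat -> q = 1%N :> nat ->
  forall a, i p = j a -> i q = i p + res e 1 -> TL_e i = 0.
Proof.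
move=> p0 q1 a ip iq; apply/TL_generator0/(TL_two R p0 q1 _ iq).
by rewrite ip weight_sum_start.
Qed.

Lemma TL_e_three (i : I ^ n) (p q s : 'I_n) : p = 0%N :> nat -> q = 1%N :> nat ->
  s = 2%N :> nat ->
  forall a b c, uniq [:: a; b; c] -> i p = j a -> i q = j b -> i s = j c -> TL_e i = 0.
Proof.
move=> p0 q1 s2 a b c abc ip iq is_; apply/TL_generator0/(TL_three R p0 q1 s2).
  by rewrite ip iq is_ -[X in uniq X]/(map j [:: a; b; c]) map_inj_uniq.
by rewrite ip iq is_ !weight_sum_start.
Qed.

Lemma TL_scalar1 : TL_scalar 1 = 1.
Proof. by rewrite -to_TL1; congr to_TL; apply: prod_ringP => O;
  rewrite -[LHS](rmorph1 (pi O)). Qed.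

Lemma TL_scalarD x z : TL_scalar (x + z) = TL_scalar x + TL_scalar z.
Proof.
rewrite -to_TLD; congr to_TL; apply: prod_ringP => O.
by rewrite /KLR_scalar [in LHS]rmorphD rmorphD.
Qed.

Lemma TL_scalarM x z : TL_scalar (x * z) = TL_scalar x * TL_scalar z.
Proof.
rewrite -to_TLM; congr to_TL; apply: prod_ringP => O.
by rewrite /KLR_scalar [in LHS]rmorphM rmorphM.
Qed.

Lemma malgC_central (O : perm_orbit n I) (c : R) (a : free_alg R O) : c%:MP * a = a * c%:MP.
Proof.
rewrite [LHS]malgM_def fgmulUg [RHS]malgM_def fgmulgU; apply: eq_bigr => m _.
by rewrite mul1m mulm1 mulrC.
Qed.

Lemma TL_scalarC x z : TL_scalar x * z = z * TL_scalar x.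
Proof.
have [Z ->] := quot_proj_surj z; rewrite -!to_TLM; congr to_TL; apply: prod_ringP => O.
have [b bE] := quot_proj_surj (Z O).
rewrite [LHS](_ : _ = pi O x%:MP * Z O) // [RHS](_ : _ = Z O * pi O x%:MP) // bE.
by rewrite -!rmorphM malgC_central.
Qed.

Lemma perm_orbit_eq (O O' : perm_orbit n I) i :
  i \in orbit_set O -> i \in orbit_set O' -> O = O'.
Proof.
move=> /Defs.mem_orbit Oi /Defs.mem_orbit O'i.
case: O O' Oi O'i => [s sP] [s' s'P] /= s_i s'_i; rewrite -s_i in s'_i.
by move: s'P; rewrite s'_i => s'P; congr PermOrbit; apply: Prop_irrelevance.
Qed.

(** At the orbit of i every component is represented by an element of the free
    algebra, which lifts to an expression in the generators of the direct sum; at the other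
    orbits e(i) is zero. *)
Lemma TL_generation (P : TL -> Prop) :
  (forall a, P (TL_scalar a)) -> (forall i, P (TL_e i)) -> (forall k, P (TL_psi k)) ->
  (forall p, P (TL_y p)) ->
  (forall x z, P x -> P z -> P (x + z)) -> (forall x z, P x -> P z -> P (x * z)) ->
  forall x i, exists2 F, P F & x * TL_e i = F * TL_e i.
Proof.
move=> Psc Pe Ppsi Py PD PM x i.
have exO : exists i0, place_orbit i = place_orbit i0 by exists i.
pose O : perm_orbit n I := PermOrbit exO.
have lift (a : free_alg R O) : exists2 G : KLR R n L, P (to_TL G) & G O = pi O a.
  have lift_gen g : exists2 G : KLR R n L, P (to_TL G) & G O = pi O (gen R g).
    case: g => [k|p|u]; [by exists (KLR_psi k); first exact: Ppsi | by exists (KLR_y p);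
      first exact: Py |].
    exists (KLR_e R L (val u)); first exact: Pe.
    by rewrite /KLR_e /orbit_e /gen_e valK.
  have lift_word (m : {fmonom generator O}) : exists2 G : KLR R n L, P (to_TL G) & G O = pi
    O << m >>.
    case: m; elim=> [|g s [G PG GO]].
      exists (KLR_scalar 1); first exact: Psc.
      by rewrite /KLR_scalar; congr (pi O << _ >>); apply/eqP; rewrite fmP fm1.
    have [G' PG' G'O] := lift_gen g; exists (G' * G); first by rewrite to_TLM; apply: PM.
    rewrite [LHS](_ : _ = G' O * G O) // GO G'O -rmorphM [X in pi O X = _]fgmulUU mulr1.
    by congr (pi O << _ >>); apply/eqP; rewrite fmP fmM fmU.
  rewrite (monalgE a); elim: (X in \sum_(k <- X) _) => [|m s [G PG GO]].
    exists (KLR_scalar 0); [exact: Psc | rewrite big_nil /KLR_scalar].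
    by rewrite [in LHS]rmorph0.
  have [G' PG' G'O] := lift_word m.
  exists (KLR_scalar a@_m * G' + G); first by rewrite to_TLD to_TLM; apply: PD => //;
    apply: PM => //; exact: Psc.
  rewrite big_cons [LHS](_ : _ = pi O (a@_m)%:MP * G' O + G O) // GO G'O -rmorphM -rmorphD.
  by congr (pi O (_ + _)); rewrite [LHS]fgmulUU mulr1 mul1m.
have [X ->] := quot_proj_surj x; have [a aE] := quot_proj_surj (X O).
have [G PG GO] := lift a; exists (to_TL G) => //.
rewrite -!to_TLM; congr to_TL; apply: (@KLR_eq_at _ _ i) => O' O'i.
- have <- : O = O'.
    apply: perm_orbit_eq O'i; apply/place_orbitP; exists 1%g; apply/ffunP => p.
    by rewrite ffunE fingroup.invg1 perm1.
  by rewrite [LHS](_ : _ = X O * KLR_e R L i O) // aE -GO.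
- by rewrite [LHS](_ : _ = X O' * KLR_e R L i O') // KLR_e_out // mulr0.
- by rewrite [LHS](_ : _ = G O' * KLR_e R L i O') // KLR_e_out // mulr0.
Qed.

(** Only finitely many orbits contribute to the direct sum. *)
Lemma TL_sum_e : exists2 B : seq (I ^ n), uniq B & \sum_(i <- B) TL_e i = 1.
Proof.
have [t tP] := KLR_finite_support R n j.
pose B := undup (flatten [seq (enum_fset s) | s <- t]).
exists B; first exact: undup_uniq.
have sumO (s : seq (I ^ n)) O : (\sum_(i <- s) KLR_e R L i : KLR R n L) O
    = pi O (\sum_(i <- s) gen_e R O i).
  elim: s => [|i s IHs]; first by rewrite !big_nil rmorph0.
  rewrite !big_cons [LHS](_ : _ = KLR_e R L i O + (\sum_(i <- s) KLR_e R L i : KLR R n L)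
    O) //.
  by rewrite IHs -rmorphD.
have -> : \sum_(i <- B) TL_e i = to_TL (\sum_(i <- B) KLR_e R L i).
  elim: B => [|i s IHs]; first by rewrite !big_nil to_TL0.
  by rewrite !big_cons to_TLD IHs.
rewrite -to_TL1; congr to_TL; apply: prod_ringP => O.
have [Ot|Ot] := boolP (orbit_set O \in t); last by rewrite !tP.
rewrite sumO [RHS](_ : _ = pi O 1); last by rewrite rmorph1.
rewrite -(KLR_relP (rel_sum R L O)); congr (pi O _).
rewrite (bigID (fun i => i \in orbit_set O)) /= [X in _ + X]big1 ?addr0; last first.
  by move=> i Oi; apply: gen_e_out.
rewrite -big_filter; apply: perm_big; apply: uniq_perm;
  rewrite ?filter_uniq ?undup_uniq ?fset_uniq //.
move=> i; rewrite mem_filter mem_undup; case: (boolP (i \in orbit_set O)) => //= Oi.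
by apply/flattenP; exists (enum_fset (orbit_set O)) => //; apply: map_f.
Qed.

Lemma TL_semisimple : (0 < n)%N -> res e 1 + res e 1 != 0 ->
  (forall a b (z : int), j a = j b + res e z -> (`|z| < n)%N -> a = b /\ z = 0) ->
  semisimple TL.
Proof.
move=> n_pos res2 far; have [B B_uniq sumB] := TL_sum_e.
exact: (semisimple_of_presentation far res2 TL_e_first TL_e_y (fun i k => TL_psi_e k i)
  TL_psi_y_next
  TL_y_next_psi TL_psi_sq TL_psi_braid TL_e_two TL_e_three n_pos TL_e_TL_e TL_psi_psi
  TL_scalar1 TL_scalarD TL_scalarM TL_scalarC TL_generation B_uniq sumB).
Qed.
End Presentation.

(** * The criterion *)

Theorem theorem5p5 (R : fieldType) (char_R : [pchar R] =i pred0)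
    (q : R) (q_neq0 : q != 0) (q_neq1 : q != 1)
    (r n : nat) (r_ge2 : (2 <= r)%N) (n_ge3 : (3 <= n)%N)
    (j : 'I_r -> residue (quantum_char q))
    (j_far : forall a b : 'I_r, a != b -> (2 < residue_dist (j a) (j b))%N) :
  semisimple (TL R n (weight_sum j)) <->
  (forall k l : 'I_r, (k < l)%N -> (n <= residue_dist (j k) (j l))%N).
Proof.
set e := quantum_char q in j j_far *.
pose a0 : 'I_r := Ordinal (ltnW r_ge2); pose a1 : 'I_r := Ordinal r_ge2.
have res_large (z : int) : res e z = 0 -> z != 0 -> (6 <= `|z|)%N.
  move=> z0 zn; have := res_eq0_large (j a0) (j a1) z0 zn; have := j_far a0 a1 isT; lia.
have res_small (z : int) : res e z = 0 -> z = 0 \/ (3 < `|z|)%N.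
  by have [->|zn] := eqVneq z 0; [left | move=> /res_large/(_ zn); right; lia].
have j_inj : injective j.
  move=> a b ab; apply: contraPeq ab => /j_far d3 ab.
  have ab0 : j a = j b + res e 0 by rewrite res0 addr0.
  by have [] := residue_dist_shift ab0; move: d3; lia.
split=> [ss k l kl|far]; last first.
  apply: TL_semisimple => //; first by apply: ltn_trans n_ge3.
    exact: (res2_neq0 res_small).
  move=> a b z jab zn; have [dab dba] := residue_dist_shift jab.
  have a_b : a = b.
    apply: contraTeq zn; rewrite -leqNgt neq_ltn => /orP[/far|/far]; lia.
  split=> //; have z0 : res e z = 0 by apply: (addrI (j b)); rewrite -jab a_b addr0.
  apply/eqP; apply: contraTT zn => /(res_eq0_large (j a0) (j a1) z0).
  by have := @far a0 a1 isT; lia.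
rewrite leqNgt; apply/negP => dn.
(* The two starts are labelled so that the second one lies below the first one. *)
have [kk [ll [kl_ne eB]]] : exists kk ll : 'I_r, kk != ll /\
    j ll = j kk - res e (residue_dist (j k) (j l))%:Z.
  have [x [z [jk jl dE]]] := residue_distP (j k) (j l).
  have [xz|zx] := leP z x.
    exists k, l; split; first by rewrite neq_ltn kl.
    by rewrite dE -jk -jl -resB; congr (res e _); lia.
  exists l, k; split; first by rewrite neq_ltn kl orbT.
  by rewrite dE -jk -jl -resB; congr (res e _); lia.
apply: (@TL_not_semisimple R e n (weight_sum j) (j kk) (j ll) _ res_small _ _ dn eB _ _ ss).
- by rewrite weight_sum_start.
- by rewrite weight_sum_start.
- move=> z /residue_dist_shift[dz _]; have := j_far _ _ kl_ne; lia.
move=> b m m12; apply/eqP; rewrite -leqn0 leqNgt; apply/negP => /weight_sum_gt0[a ja].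
have {}ja : j a = j (if b then ll else kk) + res e (- m%:Z) by rewrite ja resN;
  case: b {ja}.
have [ab|/j_far] := eqVneq a (if b then ll else kk); last first.
  by have [] := residue_dist_shift ja; lia.
have m0 : res e (- m%:Z) = 0 by apply: (addrI (j a)); rewrite addr0 {1}ab -ja.
by have := res_large _ m0; lia.
Qed.
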